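(* Let $b=1$ and let $C_\omega\in\mathbb R$, $C_\omega\neq0$. Consider velocity fields of the form $$v_R=\frac{G(x)}{r},\qquad v_\alpha=\frac{F(x)}{r},\qquad v_\theta=\frac{\Omega(x)}{r},\qquad x=\cos\alpha,\quad r=R\sin\alpha .$$ The triples $(F,G,\Omega)$ for which $\mathbf v$, together with some scalar pressure $p$, is a classical solution of the steady incompressible Euler equations $$(\mathbf v\cdot\nabla)\mathbf v=-\nabla p,\qquad \nabla\cdot\mathbf v=0$$ in $\{R>0,\ 0<\alpha<\pi/2\}$, subject to the conditions $$F(0)=0,\qquad \lim_{x\to1^-}F(x)=0,\qquad \lim_{x\to1^-}\Omega(x)=C_\omega,$$ are exactly those of the form $$\Omega(x)= C_\omega,\qquad F(x)=C_1\sqrt{x(1-x)},\qquad G(x)=C_1\,\frac{(1-2x)\sqrt{1+x}}{2\sqrt{x}}\qquad (0<x<1)$$ with $C_1\in\mathbb R$.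
   Context: Spherical coordinates $(R,\alpha,\theta)$ on $\mathbb R^3$: $R$ is the distance to the origin, $\alpha$ is the angle between the radius vector and the positive $z$-axis, and $\theta$ is the meridian angle about the $z$-axis; $\alpha=0$ is the vortex axis and $\alpha=\pi/2$ is the ground plane. The components $v_R,v_\alpha,v_\theta$ of $\mathbf v$ are taken with respect to the orthonormal spherical frame $(\mathbf e_R,\mathbf e_\alpha,\mathbf e_\theta)$, and $r=R\sin\alpha$ is the distance to the $z$-axis. The scaled pressure $p=p(R,\alpha,\theta)$ is a single-valued $C^1$ function, hence $2\pi$-periodic in $\theta$. ''Classical'' means that all derivatives of $F,G,\Omega$ occurring in the equations after elimination of the pressure exist and are continuous on the open interval $(0,1)$ ($F\in C^3(0,1)$, $G\in C^2(0,1)$, $\Omega\in C^1(0,1)$), and the equations hold pointwise. $F$ extends continuously to $x=0$ (with value $F(0)=0$, expressing that there is no source or sink at the ground); slip at the ground is allowed, so no condition is imposed on $G$ and $\Omega$ at $x=0$. *)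

(* Defs.v *)
From Stdlib Require Import Reals.
From Coquelicot Require Import Coquelicot.
Open Scope R_scope.

(** * Vector calculus on R^3 in Cartesian coordinates *)

Definition vec : Type := (R * R * R)%type.

Definition px (q : vec) : R := fst (fst q).
Definition py (q : vec) : R := snd (fst q).
Definition pz (q : vec) : R := snd q.

Definition dot (a b : vec) : R := px a * px b + py a * py b + pz a * pz b.

Definition Dx (f : vec -> R) (q : vec) : R :=
  Derive (fun t => f (t, py q, pz q)) (px q).
Definition Dy (f : vec -> R) (q : vec) : R :=
  Derive (fun t => f (px q, t, pz q)) (py q).
Definition Dz (f : vec -> R) (q : vec) : R :=
  Derive (fun t => f (px q, py q, t)) (pz q).

(** [Derive] is total, so existence of the partial derivatives is stated
    separately wherever an equation uses them. *)
Definition ex_partials (f : vec -> R) (q : vec) : Prop :=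
  ex_derive (fun t => f (t, py q, pz q)) (px q) /\
  ex_derive (fun t => f (px q, t, pz q)) (py q) /\
  ex_derive (fun t => f (px q, py q, t)) (pz q).

(** For an open [D] this is the usual C^1 property; continuity of the partial
    derivatives is joint continuity on R^3. *)
Definition C1_on (D : vec -> Prop) (f : vec -> R) : Prop :=
  forall q, D q ->
    ex_partials f q /\
    continuous (Dx f) q /\ continuous (Dy f) q /\ continuous (Dz f) q.

Definition grad (f : vec -> R) (q : vec) : vec := (Dx f q, Dy f q, Dz f q).

Definition div (u : vec -> vec) (q : vec) : R :=
  Dx (fun s => px (u s)) q + Dy (fun s => py (u s)) q
  + Dz (fun s => pz (u s)) q.

(** The convective term (u . nabla) u. *)
Definition convect (u : vec -> vec) (q : vec) : vec :=
  (dot (u q) (grad (fun s => px (u s)) q),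
   dot (u q) (grad (fun s => py (u s)) q),
   dot (u q) (grad (fun s => pz (u s)) q)).

Definition steady_euler (D : vec -> Prop) (u : vec -> vec) (p : vec -> R) : Prop :=
  forall q, D q ->
    ex_partials (fun s => px (u s)) q /\
    ex_partials (fun s => py (u s)) q /\
    ex_partials (fun s => pz (u s)) q /\
    convect u q = (- Dx p q, - Dy p q, - Dz p q) /\
    div u q = 0.

(** * Spherical coordinates

    [a] is the angle from the positive z-axis and [th] the meridian angle. *)

Definition sph (rho a th : R) : vec :=
  (rho * sin a * cos th, rho * sin a * sin th, rho * cos a).

Definition e_R (a th : R) : vec := (sin a * cos th, sin a * sin th, cos a).
Definition e_alpha (a th : R) : vec := (cos a * cos th, cos a * sin th, - sin a).
Definition e_theta (a th : R) : vec := (- sin th, cos th, 0).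

(** The upper half space with the vortex axis removed. *)
Definition flow_domain (q : vec) : Prop :=
  exists rho a th, 0 < rho /\ 0 < a < PI / 2 /\ q = sph rho a th.

(** As the frame is orthonormal, these equations determine [u] on
    [flow_domain]. *)
Definition conical_field (F G Om : R -> R) (u : vec -> vec) : Prop :=
  forall rho a th, 0 < rho -> 0 < a < PI / 2 ->
    let r := rho * sin a in
    let x := cos a in
    dot (u (sph rho a th)) (e_R a th) = G x / r /\
    dot (u (sph rho a th)) (e_alpha a th) = F x / r /\
    dot (u (sph rho a th)) (e_theta a th) = Om x / r.

(** * Classical solutions *)

(** [f] is of class C^n on the open interval (0,1). *)
Definition Cn_01 (n : nat) (f : R -> R) : Prop :=
  forall k x, (k <= n)%nat -> 0 < x < 1 ->
    ex_derive_n f k x /\ continuous (Derive_n f k) x.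

(** The pressure is a function of the position in R^3, which makes it
    single-valued: as a function of the spherical coordinates it is
    2 PI-periodic in the meridian angle. *)
Definition classical_solution (F G Om : R -> R) : Prop :=
  Cn_01 3 F /\ Cn_01 2 G /\ Cn_01 1 Om /\
  exists (u : vec -> vec) (p : vec -> R),
    conical_field F G Om u /\ C1_on flow_domain p /\
    steady_euler flow_domain u p.

(* Main.v *)
From Stdlib Require Import Reals Lra Lia Psatz.
From Coquelicot Require Import Coquelicot.
Require Import Defs.
Open Scope R_scope.

(** On the flow domain [u] is the axisymmetric field [(m X - n Y, m Y + n X, w)]
    with [m], [n], [w] functions of [r] and [z], which turns the Cartesian Euler
    equations into [G = sin a * F'], [dp/dR = A / R^3], [dp/da = B / R^2] and
    [dp/dtheta = F Omega' / R^2].  Periodicity of [p] gives [F Omega' = 0], and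
    compatibility of the first two pressure equations, [dA/da = - 2 B], amounts to
    [H''' (1 - x^2) = - 4 Omega Omega'] for [H = F^2].  Where [Omega'] does not
    vanish, [F] vanishes in a neighbourhood, so this last equation forces
    [Omega Omega' = 0] everywhere.  Hence [Omega] is constant and [F^2] is
    quadratic with zeros at [0] and [1].  Conversely, the pressure is
    [C1^2 / (2 R (R + Z)) - Comega^2 / (2 r^2)]. *)

(** * Axisymmetric fields in Cartesian coordinates *)

(** The equations are stated with Cartesian partial derivatives, while the argument lives in the
    spherical frame. For the velocity the transfer is made on explicit formulas. The pressure is
    known only through its continuous partials, so there the transfer needs the theorem that these
    imply differentiability, which gives the chain rule along coordinate curves. The identity F
    Omega' = 0 holds pointwise and does not by itself make one factor vanish identically; continuity
    of Omega' turns it into a local statement. Both integrations end with a square, Omega^2 and F^2,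
    and the sign of the root could still vary from point to point. This is excluded because a
    differentiable function on (0, 1) with constant square is constant, a fact applied to Omega and
    to F / sqrt (x (1 - x)). *)

Definition meridional_dist (q : vec) : R := sqrt (px q ^ 2 + py q ^ 2).

(** [m] and [n] are the cylindrical radial and azimuthal velocities divided by r. With this scaling
    the unit vectors X/r and Y/r never appear, and the Cartesian components are linear in X and
    Y. *)
Definition swirl (m n w : R -> R -> R) (q : vec) : vec :=
  let r := meridional_dist q in
  (m r (pz q) * px q - n r (pz q) * py q,
   m r (pz q) * py q + n r (pz q) * px q,
   w r (pz q)).

Lemma is_derive_norm2_l (f : R -> R) (x y d : R) :
  0 < x ^ 2 + y ^ 2 ->
  is_derive f (sqrt (x ^ 2 + y ^ 2)) d ->
  is_derive (fun t => f (sqrt (t ^ 2 + y ^ 2))) x (d * (x / sqrt (x ^ 2 + y ^ 2))).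
Proof.
intros h hf.
replace (d * _) with (scal (x / sqrt (x ^ 2 + y ^ 2)) d)
  by (unfold scal; simpl; unfold mult; simpl; ring).
apply (is_derive_comp f (fun t => sqrt (t ^ 2 + y ^ 2)) x d); [exact hf|].
assert (h' := sqrt_lt_R0 _ h).
auto_derive; [lra|].
simpl in *; field; lra.
Qed.

Lemma is_derive_norm2_r (f : R -> R) (x y d : R) :
  0 < x ^ 2 + y ^ 2 ->
  is_derive f (sqrt (x ^ 2 + y ^ 2)) d ->
  is_derive (fun t => f (sqrt (x ^ 2 + t ^ 2))) y (d * (y / sqrt (x ^ 2 + y ^ 2))).
Proof.
intros h hf; rewrite (Rplus_comm (x ^ 2)) in h, hf |- *.
apply is_derive_ext with (fun t => f (sqrt (t ^ 2 + x ^ 2))).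
- intros t; now rewrite Rplus_comm.
- now apply is_derive_norm2_l.
Qed.

Section Swirl.

Variables (m n w : R -> R -> R) (q : vec) (mr mz nr nz wr wz : R).
Let X := px q.
Let Y := py q.
Let Z := pz q.
Let r := meridional_dist q.
Hypothesis q_off_axis : 0 < X ^ 2 + Y ^ 2.
Hypothesis Dmr : is_derive (fun t => m t Z) r mr.
Hypothesis Dmz : is_derive (fun t => m r t) Z mz.
Hypothesis Dnr : is_derive (fun t => n t Z) r nr.
Hypothesis Dnz : is_derive (fun t => n r t) Z nz.
Hypothesis Dwr : is_derive (fun t => w t Z) r wr.
Hypothesis Dwz : is_derive (fun t => w r t) Z wz.

Let ux s := px (swirl m n w s).
Let uy s := py (swirl m n w s).
Let uz s := pz (swirl m n w s).

(** Along each coordinate line, [ux] and [uy] combine [m] and [n] with weights that are affine in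
    the moving coordinate, so this one product rule serves all six of their partial derivatives. *)
Lemma is_derive_lin_comb (f g : R -> R) (x a b f' g' c e : R) :
  is_derive f x f' -> is_derive g x g' ->
  is_derive (fun t => f t * (a * t + b) + g t * (c * t + e)) x
    (f' * (a * x + b) + f x * a + (g' * (c * x + e) + g x * c)).
Proof.
intros hf hg.
assert (Ef : Derive (fun x => f x) x = f') by (now apply is_derive_unique).
assert (Eg : Derive (fun x => g x) x = g') by (now apply is_derive_unique).
auto_derive; [repeat split; [now exists f' | now exists g']|].
rewrite Ef, Eg; ring.
Qed.

Lemma swirl_partials :
  (is_derive (fun t : R => ux (t, Y, Z)) X (mr * X / r * X + m r Z - nr * X / r * Y) /\
   is_derive (fun t : R => ux (X, t, Z)) Y (mr * Y / r * X - nr * Y / r * Y - n r Z) /\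
   is_derive (fun t : R => ux (X, Y, t)) Z (mz * X - nz * Y)) /\
  (is_derive (fun t : R => uy (t, Y, Z)) X (mr * X / r * Y + nr * X / r * X + n r Z) /\
   is_derive (fun t : R => uy (X, t, Z)) Y (mr * Y / r * Y + m r Z + nr * Y / r * X) /\
   is_derive (fun t : R => uy (X, Y, t)) Z (mz * Y + nz * X)) /\
  (is_derive (fun t : R => uz (t, Y, Z)) X (wr * X / r) /\
   is_derive (fun t : R => uz (X, t, Z)) Y (wr * Y / r) /\
   is_derive (fun t : R => uz (X, Y, t)) Z wz).
Proof.
assert (hr : 0 < r) by (now apply sqrt_lt_R0).
assert (mx := is_derive_norm2_l _ _ _ _ q_off_axis Dmr).
assert (my := is_derive_norm2_r _ _ _ _ q_off_axis Dmr).
assert (nx := is_derive_norm2_l _ _ _ _ q_off_axis Dnr).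
assert (ny := is_derive_norm2_r _ _ _ _ q_off_axis Dnr).
assert (wx := is_derive_norm2_l _ _ _ _ q_off_axis Dwr).
assert (wy := is_derive_norm2_r _ _ _ _ q_off_axis Dwr).
assert (Er : sqrt (X ^ 2 + Y ^ 2) = r) by reflexivity.
unfold ux, uy, uz, swirl, meridional_dist, px, py, pz; cbn [fst snd].
refine (conj (conj _ (conj _ _)) (conj (conj _ (conj _ _)) (conj _ (conj _ _)))); cbn [fst snd].
- eapply is_derive_ext; [|evar_last; [apply (is_derive_lin_comb _ _ _ 1 0 _ _ 0 (- Y) mx nx)|]].
  + intros t; cbn; ring.
  + cbn beta; rewrite Er; field; lra.
- eapply is_derive_ext; [|evar_last; [apply (is_derive_lin_comb _ _ _ 0 X _ _ (-1) 0 my ny)|]].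
  + intros t; cbn; ring.
  + cbn beta; rewrite Er; field; lra.
- eapply is_derive_ext; [|evar_last; [apply (is_derive_lin_comb _ _ _ 0 X _ _ 0 (- Y) Dmz Dnz)|]].
  + intros t; change (m r t * (0 * t + X) + n r t * (0 * t + - Y) = m r t * X - n r t * Y); ring.
  + cbn beta; ring.
- eapply is_derive_ext; [|evar_last; [apply (is_derive_lin_comb _ _ _ 0 Y _ _ 1 0 mx nx)|]].
  + intros t; cbn; ring.
  + cbn beta; rewrite Er; field; lra.
- eapply is_derive_ext; [|evar_last; [apply (is_derive_lin_comb _ _ _ 1 0 _ _ 0 X my ny)|]].
  + intros t; cbn; ring.
  + cbn beta; rewrite Er; field; lra.
- eapply is_derive_ext; [|evar_last; [apply (is_derive_lin_comb _ _ _ 0 Y _ _ 0 X Dmz Dnz)|]].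
  + intros t; change (m r t * (0 * t + Y) + n r t * (0 * t + X) = m r t * Y + n r t * X); ring.
  + cbn beta; ring.
- unfold Rdiv; rewrite Rmult_assoc; exact wx.
- unfold Rdiv; rewrite Rmult_assoc; exact wy.
- exact Dwz.
Qed.

Lemma swirl_ex_partials : ex_partials ux q /\ ex_partials uy q /\ ex_partials uz q.
Proof.
destruct swirl_partials as ((a1 & a2 & a3) & (b1 & b2 & b3) & c1 & c2 & c3).
repeat split; eexists; eassumption.
Qed.

(** [r * a] and [r * b] are the cylindrical radial and azimuthal accelerations for v_r = r m and
    v_theta = r n: the term - n^2 is the centripetal part - v_theta^2 / r, and half of 2 m n is the
    part v_r v_theta / r. The convective term thus has the same swirl form as the field. *)
Lemma swirl_convect :
  let a := r * m r Z * mr + w r Z * mz + m r Z ^ 2 - n r Z ^ 2 in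
  let b := r * m r Z * nr + w r Z * nz + 2 * m r Z * n r Z in
  convect (swirl m n w) q =
  (X * a - Y * b, Y * a + X * b, r * m r Z * wr + w r Z * wz).
Proof.
destruct swirl_partials as ((a1 & a2 & a3) & (b1 & b2 & b3) & c1 & c2 & c3).
assert (hr : 0 < r) by (now apply sqrt_lt_R0).
assert (Er : X ^ 2 = r ^ 2 - Y ^ 2)
  by (unfold r, meridional_dist; fold X Y; rewrite pow2_sqrt; lra).
apply is_derive_unique in a1, a2, a3, b1, b2, b3, c1, c2, c3.
change (convect (swirl m n w) q) with
  ((m r Z * X - n r Z * Y) * Derive (fun t => ux (t, Y, Z)) X
   + (m r Z * Y + n r Z * X) * Derive (fun t => ux (X, t, Z)) Y
   + w r Z * Derive (fun t => ux (X, Y, t)) Z,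
   (m r Z * X - n r Z * Y) * Derive (fun t => uy (t, Y, Z)) X
   + (m r Z * Y + n r Z * X) * Derive (fun t => uy (X, t, Z)) Y
   + w r Z * Derive (fun t => uy (X, Y, t)) Z,
   (m r Z * X - n r Z * Y) * Derive (fun t => uz (t, Y, Z)) X
   + (m r Z * Y + n r Z * X) * Derive (fun t => uz (X, t, Z)) Y
   + w r Z * Derive (fun t => uz (X, Y, t)) Z).
rewrite a1, a2, a3, b1, b2, b3, c1, c2, c3.
assert (hr0 : r <> 0) by lra.
generalize (m r Z) (n r Z) (w r Z); intros m0 n0 w0.
cbv zeta.
clearbody X Y r.
f_equal; [f_equal|]; field [Er]; exact hr0.
Qed.

(** This is (1/r) d(r v_r)/dr + dw/dz with v_r = r m. *)
Lemma swirl_div : div (swirl m n w) q = 2 * m r Z + r * mr + wz.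
Proof.
destruct swirl_partials as ((a1 & a2 & a3) & (b1 & b2 & b3) & c1 & c2 & c3).
assert (hr : 0 < r) by (now apply sqrt_lt_R0).
assert (Er : X ^ 2 = r ^ 2 - Y ^ 2)
  by (unfold r, meridional_dist; fold X Y; rewrite pow2_sqrt; lra).
apply is_derive_unique in a1, b2, c3.
change (div (swirl m n w) q) with
  (Derive (fun t => ux (t, Y, Z)) X + Derive (fun t => uy (X, t, Z)) Y
   + Derive (fun t => uz (X, Y, t)) Z).
rewrite a1, b2, c3.
assert (hr0 : r <> 0) by lra.
generalize (m r Z) (n r Z) (w r Z); intros m0 n0 w0.
clearbody X Y r.
field [Er]; exact hr0.
Qed.


End Swirl.

(** * Spherical geometry of the flow domain *)

Lemma sin_cos_sqr (t : R) : sin t ^ 2 = 1 - cos t ^ 2.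
Proof. generalize (sin2_cos2 t); unfold Rsqr; lra. Qed.

Lemma sin_cos_pos (a : R) : 0 < a < PI / 2 -> 0 < sin a < 1 /\ 0 < cos a < 1.
Proof.
intros ha.
assert (hs : 0 < sin a) by (apply sin_gt_0; lra).
assert (hc : 0 < cos a) by (apply cos_gt_0; lra).
assert (h := sin_cos_sqr a).
repeat split; nra.
Qed.

Lemma unit_circle_angle (c s : R) :
  c ^ 2 + s ^ 2 = 1 -> exists t, cos t = c /\ sin t = s.
Proof.
intros h.
assert (hc : -1 <= c <= 1) by nra.
assert (Es : s ^ 2 = sqrt (1 - c²) ^ 2).
{ rewrite pow2_sqrt; unfold Rsqr; nra. }
assert (hp := sqrt_pos (1 - c²)).
destruct (Rle_dec 0 s) as [hs|hs].
- exists (acos c); rewrite cos_acos, sin_acos by lra; split; [easy|]; nra.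
- exists (- acos c); rewrite cos_neg, sin_neg, cos_acos, sin_acos by lra.
  split; [easy|]; nra.
Qed.

Lemma cos_surj_01 (x : R) : 0 < x < 1 -> exists a, 0 < a < PI / 2 /\ cos a = x.
Proof.
intros hx.
assert (ca : cos (acos x) = x) by (apply cos_acos; lra).
exists (acos x); split; [|easy].
destruct (acos_bound x) as [h0 h1]; assert (hpi := PI_RGT_0).
split; apply Rnot_le_lt; intros h2.
- replace (acos x) with 0 in ca by lra; rewrite cos_0 in ca; lra.
- apply cos_le_0 in h2; lra.
Qed.

(** Strict polynomial inequalities make openness of the domain immediate. The converse direction has
    to recover both angles from a Cartesian point. *)
Lemma flow_domain_iff (q : vec) :
  flow_domain q <-> 0 < px q ^ 2 + py q ^ 2 /\ 0 < pz q.
Proof.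
split.
- intros (rho & a & th & hrho & ha & ->); unfold sph, px, py, pz; simpl fst; simpl snd.
  destruct (sin_cos_pos _ ha) as [hs hc].
  split; [|nra].
  assert (E : (rho * sin a * cos th) ^ 2 + (rho * sin a * sin th) ^ 2 = (rho * sin a) ^ 2)
    by (ring [(sin_cos_sqr th)]).
  rewrite E; apply pow_lt; nra.
- destruct q as [[x y] z]; unfold px, py, pz; simpl fst; simpl snd; intros [h hz].
  set (r := sqrt (x ^ 2 + y ^ 2)).
  assert (hr : 0 < r) by (now apply sqrt_lt_R0).
  assert (Er : r ^ 2 = x ^ 2 + y ^ 2) by (unfold r; rewrite pow2_sqrt; lra).
  set (d := sqrt (r ^ 2 + z ^ 2)).
  assert (hd : 0 < d) by (apply sqrt_lt_R0; nra).
  assert (Ed : d ^ 2 = r ^ 2 + z ^ 2) by (unfold d; rewrite pow2_sqrt; nra).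
  destruct (unit_circle_angle (x / r) (y / r)) as (th & Ec & Es).
  { field_simplify_eq; lra. }
  assert (hzd : 0 < z / d < 1).
  { split; [now apply Rdiv_lt_0_compat|].
    apply Rmult_lt_reg_r with d; [easy|].
    unfold Rdiv; rewrite Rmult_assoc, Rinv_l; nra. }
  destruct (cos_surj_01 _ hzd) as (a & ha & ca).
  assert (hsa := proj1 (proj1 (sin_cos_pos _ ha))).
  assert (sa : sin a = r / d).
  { assert (E : sin a ^ 2 = (r / d) ^ 2).
    { rewrite sin_cos_sqr, ca; field_simplify_eq; lra. }
    assert (0 < r / d) by (now apply Rdiv_lt_0_compat).
    nra. }
  exists d, a, th; repeat split; [easy..|].
  unfold sph; rewrite ca, sa, Ec, Es.
  f_equal; [f_equal|]; field; lra.
Qed.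

Lemma continuous_px (q : vec) : continuous px q.
Proof. apply (continuous_comp fst fst); apply continuous_fst. Qed.

Lemma continuous_py (q : vec) : continuous py q.
Proof. apply (continuous_comp fst snd); [apply continuous_fst|apply continuous_snd]. Qed.

Lemma continuous_pz (q : vec) : continuous pz q.
Proof. apply continuous_snd. Qed.

Lemma continuous_pow {U : UniformSpace} (f : U -> R) (n : nat) (u : U) :
  continuous f u -> continuous (fun v => f v ^ n) u.
Proof.
intros hf; induction n as [|n IH]; simpl; [apply continuous_const|].
now apply (continuous_mult f).
Qed.

Lemma flow_domain_open (q : vec) : flow_domain q -> locally q flow_domain.
Proof.
intros h; apply flow_domain_iff in h; destruct h as [h hz].
assert (c1 : continuous (fun s : vec => px s ^ 2 + py s ^ 2) q).
{ apply (continuous_plus (fun s : vec => px s ^ 2) (fun s : vec => py s ^ 2));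
  apply continuous_pow; [apply continuous_px|apply continuous_py]. }
assert (l1 : locally q (fun s : vec => 0 < px s ^ 2 + py s ^ 2))
  by (exact (c1 _ (open_gt 0 _ h))).
assert (l2 : locally q (fun s : vec => 0 < pz s))
  by (exact (continuous_pz q _ (open_gt 0 _ hz))).
generalize (filter_and _ _ l1 l2); apply filter_imp.
intros s hs; now apply flow_domain_iff.
Qed.

(** * Locality of the Euler system on an open set, and the explicit conical field *)

Lemma locally_sections (D : vec -> Prop) (q : vec) :
  locally q D ->
  locally (px q) (fun t => D (t, py q, pz q)) /\
  locally (py q) (fun t => D (px q, t, pz q)) /\
  locally (pz q) (fun t => D (px q, py q, t)).
Proof.
intros [e he].
refine (conj _ (conj _ _)); exists e; intros t ht; apply he;
repeat split; try exact ht; apply ball_center.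
Qed.

Lemma partials_ext (D : vec -> Prop) (f g : vec -> R) (q : vec) :
  (forall s, D s -> f s = g s) -> locally q D ->
  (ex_partials f q -> ex_partials g q) /\
  Dx f q = Dx g q /\ Dy f q = Dy g q /\ Dz f q = Dz g q.
Proof.
intros h hq; destruct (locally_sections _ _ hq) as (l1 & l2 & l3).
refine (conj _ (conj _ (conj _ _))).
- intros (e1 & e2 & e3); refine (conj _ (conj _ _));
  eapply ex_derive_ext_loc; try eassumption;
  eapply filter_imp; try eassumption; intros t ht; now apply h.
- apply Derive_ext_loc; revert l1; apply filter_imp; intros t; apply h.
- apply Derive_ext_loc; revert l2; apply filter_imp; intros t; apply h.
- apply Derive_ext_loc; revert l3; apply filter_imp; intros t; apply h.
Qed.

(** The fields agree on [D] and may differ elsewhere. Partial derivatives at a point depend on a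
    neighbourhood, so openness of [D] carries the agreement over to them. *)
Lemma steady_euler_ext (D : vec -> Prop) (u v : vec -> vec) (p : vec -> R) :
  (forall q, D q -> locally q D) -> (forall q, D q -> u q = v q) ->
  steady_euler D u p -> steady_euler D v p.
Proof.
intros hD h he q hq.
destruct (he q hq) as (e1 & e2 & e3 & ec & ed).
destruct (partials_ext D (fun s => px (u s)) (fun s => px (v s)) q) as (x1 & x2 & x3 & x4);
  [now intros s hs; rewrite h|now apply hD|].
destruct (partials_ext D (fun s => py (u s)) (fun s => py (v s)) q) as (y1 & y2 & y3 & y4);
  [now intros s hs; rewrite h|now apply hD|].
destruct (partials_ext D (fun s => pz (u s)) (fun s => pz (v s)) q) as (z1 & z2 & z3 & z4);
  [now intros s hs; rewrite h|now apply hD|].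
refine (conj (x1 e1) (conj (y1 e2) (conj (z1 e3) (conj _ _)))).
- rewrite <- ec; unfold convect, grad.
  rewrite x2, x3, x4, y2, y3, y4, z2, z3, z4, h; easy.
- rewrite <- ed; unfold div; now rewrite x2, y3, z4.
Qed.

(** The radial cylindrical velocity is (G sin a + F cos a) / r and the vertical one (G cos a - F sin
    a) / r. Put sin a = r/d and cos a = z/d, and divide the horizontal components by one more r to
    obtain [m] and [n]. *)
Definition coef_m (F G : R -> R) (r z : R) : R :=
  let d := sqrt (r ^ 2 + z ^ 2) in G (z / d) / (r * d) + F (z / d) * z / (d * r ^ 2).
Definition coef_n (Om : R -> R) (r z : R) : R :=
  Om (z / sqrt (r ^ 2 + z ^ 2)) / r ^ 2.
Definition coef_w (F G : R -> R) (r z : R) : R :=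
  let d := sqrt (r ^ 2 + z ^ 2) in G (z / d) * z / (r * d) - F (z / d) / d.

Definition conical (F G Om : R -> R) : vec -> vec :=
  swirl (coef_m F G) (coef_n Om) (coef_w F G).

Lemma meridional_dist_sph (rho a th : R) :
  0 < rho -> 0 < a < PI / 2 -> meridional_dist (sph rho a th) = rho * sin a.
Proof.
intros hrho ha; destruct (sin_cos_pos _ ha) as [hs hc].
unfold meridional_dist, sph, px, py; simpl fst; simpl snd.
replace (_ + _) with ((rho * sin a) ^ 2) by (ring [(sin_cos_sqr th)]).
apply sqrt_pow2; nra.
Qed.

Lemma norm_sph (rho a : R) :
  0 < rho -> sqrt ((rho * sin a) ^ 2 + (rho * cos a) ^ 2) = rho.
Proof.
intros hrho.
replace (_ + _) with (rho ^ 2) by (ring [(sin_cos_sqr a)]).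
apply sqrt_pow2; lra.
Qed.

Lemma cos_sph (rho a : R) : 0 < rho -> rho * cos a / rho = cos a.
Proof. intros; field; lra. Qed.

Lemma conical_sph (F G Om : R -> R) (rho a th : R) :
  0 < rho -> 0 < a < PI / 2 ->
  let r := rho * sin a in
  let x := cos a in
  conical F G Om (sph rho a th) =
  ((G x * sin a + F x * cos a) / r * cos th - Om x / r * sin th,
   (G x * sin a + F x * cos a) / r * sin th + Om x / r * cos th,
   (G x * cos a - F x * sin a) / r).
Proof.
intros hrho ha; destruct (sin_cos_pos _ ha) as [hs hc].
unfold conical, swirl, coef_m, coef_n, coef_w; cbv zeta.
rewrite meridional_dist_sph by easy.
change (pz (sph rho a th)) with (rho * cos a).
change (px (sph rho a th)) with (rho * sin a * cos th).
change (py (sph rho a th)) with (rho * sin a * sin th).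
rewrite norm_sph, cos_sph by easy.
f_equal; [f_equal|]; field; lra.
Qed.

Lemma conical_field_conical (F G Om : R -> R) : conical_field F G Om (conical F G Om).
Proof.
intros rho a th hrho ha r x; destruct (sin_cos_pos _ ha) as [hs hc].
rewrite conical_sph by easy.
unfold dot, e_R, e_alpha, e_theta, px, py, pz, r, x; simpl fst; simpl snd.
repeat split; field [(sin_cos_sqr a) (sin_cos_sqr th)]; lra.
Qed.

(** The frame is inverted by hand: cos a e_R - sin a e_alpha is the vertical unit vector, which
    yields [E3]; sin a e_R + cos a e_alpha is the horizontal one (cos th, sin th, 0), which yields
    [E]; a rotation by [th] then separates the two horizontal components. *)
Lemma frame_eq (a th : R) (u v : vec) :
  dot u (e_R a th) = dot v (e_R a th) ->
  dot u (e_alpha a th) = dot v (e_alpha a th) ->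
  dot u (e_theta a th) = dot v (e_theta a th) -> u = v.
Proof.
destruct u as [[u1 u2] u3], v as [[v1 v2] v3].
unfold dot, e_R, e_alpha, e_theta, px, py, pz; simpl fst; simpl snd.
intros h1 h2 h3.
assert (ha := sin_cos_sqr a); assert (ht := sin_cos_sqr th).
assert (E3 : u3 = v3).
{ transitivity (u3 * (sin a ^ 2 + cos a ^ 2)); [rewrite ha; ring|].
  transitivity (v3 * (sin a ^ 2 + cos a ^ 2)); [|rewrite ha; ring].
  apply Rminus_diag_uniq.
  apply Rminus_diag_eq in h1, h2.
  transitivity (cos a * 0 - sin a * 0); [rewrite <- h1 at 1; rewrite <- h2; ring|ring]. }
subst v3.
assert (E : (u1 - v1) * cos th + (u2 - v2) * sin th = 0).
{ transitivity (((u1 - v1) * cos th + (u2 - v2) * sin th) * (sin a ^ 2 + cos a ^ 2));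
    [rewrite ha; ring|].
  apply Rminus_diag_eq in h1, h2.
  transitivity (sin a * 0 + cos a * 0); [rewrite <- h1 at 1; rewrite <- h2; ring|ring]. }
apply Rminus_diag_eq in h3.
assert (E1 : u1 - v1 = 0).
{ transitivity ((u1 - v1) * (sin th ^ 2 + cos th ^ 2)); [rewrite ht; ring|].
  transitivity (cos th * 0 - sin th * 0); [rewrite <- E at 1; rewrite <- h3; ring|ring]. }
assert (E2 : u2 - v2 = 0).
{ transitivity ((u2 - v2) * (sin th ^ 2 + cos th ^ 2)); [rewrite ht; ring|].
  transitivity (sin th * 0 + cos th * 0); [rewrite <- E at 1; rewrite <- h3; ring|ring]. }
f_equal; f_equal; lra.
Qed.

Lemma conical_field_unique (F G Om : R -> R) (u : vec -> vec) :
  conical_field F G Om u -> forall q, flow_domain q -> u q = conical F G Om q.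
Proof.
intros hu q (rho & a & th & hrho & ha & ->).
destruct (hu rho a th hrho ha) as (h1 & h2 & h3).
destruct (conical_field_conical F G Om rho a th hrho ha) as (k1 & k2 & k3).
apply (frame_eq a th); congruence.
Qed.

(** Replaces the unknown field by the explicit one, so that the pressure is the only unknown
    left. *)
Lemma classical_solution_iff (F G Om : R -> R) :
  classical_solution F G Om <->
  Cn_01 3 F /\ Cn_01 2 G /\ Cn_01 1 Om /\
  exists p, C1_on flow_domain p /\ steady_euler flow_domain (conical F G Om) p.
Proof.
split; intros (hF & hG & hO & h); refine (conj hF (conj hG (conj hO _))).
- destruct h as (u & p & hu & hp & he); exists p; split; [easy|].
  eapply steady_euler_ext; [apply flow_domain_open| |exact he].
  now apply conical_field_unique.
- destruct h as (p & hp & he); exists (conical F G Om), p.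
  split; [apply conical_field_conical|easy].
Qed.

(** * Derivatives of a function of the cone angle *)

Section ConeAngle.

Variables rho a : R.
Hypotheses (rho_gt0 : 0 < rho) (a_range : 0 < a < PI / 2).
Let S := sin a.
Let C := cos a.

(** For x = z / rho one has dx/dr = - r z / rho^3 = - S C / rho; in the companion lemma, dx/dz = r^2
    / rho^3 = S^2 / rho. *)
Lemma is_derive_cone_r (f : R -> R) (d : R) :
  is_derive f C d ->
  is_derive (fun t => f (rho * C / sqrt (t ^ 2 + (rho * C) ^ 2))) (rho * S) (d * (- S * C / rho)).
Proof.
intros hf; destruct (sin_cos_pos _ a_range) as [hs hc].
assert (N := norm_sph rho a rho_gt0); fold S C in N, hs, hc.
evar_last.
- apply (is_derive_comp f (fun t => rho * C / sqrt (t ^ 2 + (rho * C) ^ 2))).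
  + rewrite N; unfold C at 1; rewrite cos_sph by easy; exact hf.
  + auto_derive; [|reflexivity].
    change ((rho * S) * ((rho * S) * 1) + rho * C * (rho * C * 1))
      with ((rho * S) ^ 2 + (rho * C) ^ 2).
    rewrite N; assert (0 < rho * S) by nra; split; [nra|lra].
- unfold scal; simpl; unfold mult; simpl.
  change ((rho * S) * ((rho * S) * 1) + rho * C * (rho * C * 1))
      with ((rho * S) ^ 2 + (rho * C) ^ 2).
  rewrite N; field; lra.
Qed.

Lemma is_derive_cone_z (f : R -> R) (d : R) :
  is_derive f C d ->
  is_derive (fun t => f (t / sqrt ((rho * S) ^ 2 + t ^ 2))) (rho * C) (d * (S ^ 2 / rho)).
Proof.
intros hf; destruct (sin_cos_pos _ a_range) as [hs hc].
assert (N := norm_sph rho a rho_gt0); fold S C in N, hs, hc.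
evar_last.
- apply (is_derive_comp f (fun t => t / sqrt ((rho * S) ^ 2 + t ^ 2))).
  + rewrite N; unfold C at 1; rewrite cos_sph by easy; exact hf.
  + auto_derive; [|reflexivity].
    change ((rho * S) * ((rho * S) * 1) + rho * C * (rho * C * 1))
      with ((rho * S) ^ 2 + (rho * C) ^ 2).
    rewrite N; assert (0 < rho * S) by nra; split; [nra|lra].
- unfold scal; simpl; unfold mult; simpl.
  change ((rho * S) * ((rho * S) * 1) + rho * C * (rho * C * 1))
      with ((rho * S) ^ 2 + (rho * C) ^ 2).
  rewrite N; unfold S, C; field [(sin_cos_sqr a)]; lra.
Qed.

End ConeAngle.

(** * Spherical components of the Euler equations *)

(** Each coefficient is a sum of products of a profile of the cone angle with an explicit kernel in
    r and z. The profile is handled by the cone-angle chain rule, the kernel by [auto_derive]. *)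
Lemma is_derive_mult_add (f k g l : R -> R) (x f' k' g' l' : R) :
  is_derive f x f' -> is_derive k x k' -> is_derive g x g' -> is_derive l x l' ->
  is_derive (fun t => f t * k t + g t * l t) x
    (f' * k x + f x * k' + (g' * l x + g x * l')).
Proof.
intros hf hk hg hl.
exact (is_derive_plus (fun t => f t * k t) (fun t => g t * l t) _ _ _
  (is_derive_mult f k x f' k' hf hk Rmult_comm) (is_derive_mult g l x g' l' hg hl Rmult_comm)).
Qed.

Lemma is_derive_Rconst (c x : R) : is_derive (fun _ : R => c) x 0.
Proof. exact (is_derive_const c x). Qed.

Section ConicalDerivatives.

Variables (F G Om : R -> R) (rho a f1 g1 o1 : R).
Hypotheses (rho_gt0 : 0 < rho) (a_range : 0 < a < PI / 2).
Let S := sin a.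
Let C := cos a.
Hypotheses (DF : is_derive F C f1) (DG : is_derive G C g1) (DOm : is_derive Om C o1).
Let r := rho * S.
Let z := rho * C.
Let d (r z : R) := sqrt (r ^ 2 + z ^ 2).

Let S_gt0 : 0 < S. Proof. exact (proj1 (proj1 (sin_cos_pos _ a_range))). Qed.
Let r_gt0 : 0 < r. Proof. now apply Rmult_lt_0_compat. Qed.
Let d_eq : sqrt (r ^ 2 + z ^ 2) = rho. Proof. now apply norm_sph. Qed.
Let x_eq (f : R -> R) : f (z / sqrt (r ^ 2 + z ^ 2)) = f C.
Proof. rewrite d_eq; unfold z, C; now rewrite cos_sph. Qed.
Let S_sqr : S ^ 2 = 1 - C ^ 2. Proof. apply sin_cos_sqr. Qed.

(* [is_derive_ext] leaves an equation in [R_NormedModule], which [ring] rejects. *)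
Ltac ring_R := cbv zeta; match goal with |- ?u = ?v => change (@eq R u v) end; ring.

Ltac derive_kernel :=
  auto_derive;
  [ change (r * (r * 1) + z * (z * 1)) with (r ^ 2 + z ^ 2); rewrite ?d_eq;
    repeat split; try apply Rgt_not_eq; repeat apply Rmult_lt_0_compat;
    first [lra | nra]
  | reflexivity ].

Ltac finish_kernel :=
  cbv beta;
  change (r * (r * 1) + z * (z * 1)) with (r ^ 2 + z ^ 2); rewrite ?x_eq, ?d_eq;
  unfold r, z; clear - S_gt0 rho_gt0 S_sqr; clearbody S C;
  field [S_sqr]; lra.

Lemma coef_m_r :
  is_derive (fun t => coef_m F G t z) r
    (g1 * (- S * C / rho) / (rho ^ 2 * S) - G C * (1 + S ^ 2) / (rho ^ 3 * S ^ 2)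
     + f1 * (- S * C / rho) * C / (rho ^ 2 * S ^ 2)
     - F C * C * (2 + S ^ 2) / (rho ^ 3 * S ^ 3)).
Proof.
apply is_derive_ext with (fun t => G (z / d t z) * (/ (t * d t z))
  + F (z / d t z) * (z / (d t z * t ^ 2))); [intros t; unfold coef_m, Rdiv, d; ring_R|].
unfold d; evar_last.
- apply is_derive_mult_add.
  + exact (is_derive_cone_r rho a rho_gt0 a_range G g1 DG).
  + derive_kernel.
  + exact (is_derive_cone_r rho a rho_gt0 a_range F f1 DF).
  + derive_kernel.
- fold S C; finish_kernel.
Qed.

Lemma coef_m_z :
  is_derive (fun t => coef_m F G r t) z
    (g1 * (S ^ 2 / rho) / (rho ^ 2 * S) - G C * C / (rho ^ 3 * S)
     + f1 * (S ^ 2 / rho) * C / (rho ^ 2 * S ^ 2) + F C / rho ^ 3).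
Proof.
apply is_derive_ext with (fun t => G (t / d r t) * (/ (r * d r t))
  + F (t / d r t) * (t / (d r t * r ^ 2))); [intros t; unfold coef_m, Rdiv, d; ring_R|].
unfold d; evar_last.
- apply is_derive_mult_add.
  + exact (is_derive_cone_z rho a rho_gt0 a_range G g1 DG).
  + derive_kernel.
  + exact (is_derive_cone_z rho a rho_gt0 a_range F f1 DF).
  + derive_kernel.
- fold S C; finish_kernel.
Qed.

Lemma coef_n_r :
  is_derive (fun t => coef_n Om t z) r
    (o1 * (- S * C / rho) / (rho ^ 2 * S ^ 2) - 2 * Om C / (rho ^ 3 * S ^ 3)).
Proof.
(* The summand [0 * 0] pads the single product to the shape of [is_derive_mult_add]. *)
apply is_derive_ext with (fun t => Om (z / d t z) * (/ t ^ 2) + 0 * 0);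
  [intros t; unfold coef_n, Rdiv, d; ring_R|].
unfold d; evar_last.
- apply is_derive_mult_add.
  + exact (is_derive_cone_r rho a rho_gt0 a_range Om o1 DOm).
  + derive_kernel.
  + apply (is_derive_Rconst 0).
  + apply (is_derive_Rconst 0).
- fold S C; finish_kernel.
Qed.

Lemma coef_n_z :
  is_derive (fun t => coef_n Om r t) z (o1 * (S ^ 2 / rho) / (rho ^ 2 * S ^ 2)).
Proof.
apply is_derive_ext with (fun t => Om (t / d r t) * (/ r ^ 2) + 0 * 0);
  [intros t; unfold coef_n, Rdiv, d; ring_R|].
unfold d; evar_last.
- apply is_derive_mult_add.
  + exact (is_derive_cone_z rho a rho_gt0 a_range Om o1 DOm).
  + apply (is_derive_Rconst (/ r ^ 2)).
  + apply (is_derive_Rconst 0).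
  + apply (is_derive_Rconst 0).
- fold S C; finish_kernel.
Qed.

Lemma coef_w_r :
  is_derive (fun t => coef_w F G t z) r
    (g1 * (- S * C / rho) * C / (rho * S) - G C * C * (1 + S ^ 2) / (rho ^ 2 * S ^ 2)
     + f1 * (S * C / rho) / rho + F C * S / rho ^ 2).
Proof.
apply is_derive_ext with (fun t => G (z / d t z) * (z / (t * d t z))
  + F (z / d t z) * (- / d t z)); [intros t; unfold coef_w, Rdiv, d; ring_R|].
unfold d; evar_last.
- apply is_derive_mult_add.
  + exact (is_derive_cone_r rho a rho_gt0 a_range G g1 DG).
  + derive_kernel.
  + exact (is_derive_cone_r rho a rho_gt0 a_range F f1 DF).
  + derive_kernel.
- fold S C; finish_kernel.
Qed.

Lemma coef_w_z :
  is_derive (fun t => coef_w F G r t) z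
    (g1 * (S ^ 2 / rho) * C / (rho * S) + G C * S / rho ^ 2
     - f1 * (S ^ 2 / rho) / rho + F C * C / rho ^ 2).
Proof.
apply is_derive_ext with (fun t => G (t / d r t) * (t / (r * d r t))
  + F (t / d r t) * (- / d r t)); [intros t; unfold coef_w, Rdiv, d; ring_R|].
unfold d; evar_last.
- apply is_derive_mult_add.
  + exact (is_derive_cone_z rho a rho_gt0 a_range G g1 DG).
  + derive_kernel.
  + exact (is_derive_cone_z rho a rho_gt0 a_range F f1 DF).
  + derive_kernel.
- fold S C; finish_kernel.
Qed.

(** This is - rho^3 times the radial convective term, hence rho^3 dp/dR. G^2 comes from v_R dv_R/dR,
    F^2 + Om^2 from the centripetal acceleration, and the last summand from (v_alpha / R)
    dv_R/dalpha. *)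
Definition radial_force (x s F G G' Om : R) : R :=
  (G ^ 2 + F ^ 2 + Om ^ 2 + F * (s * G' + x * G / s)) / s ^ 2.
(** [G] is absent because v_R dv_alpha/dR and v_R v_alpha / R cancel, v_alpha being homogeneous of
    degree -1 in R. *)
Definition polar_force (x s F F' Om : R) : R :=
  F * F' / s + x * (F ^ 2 + Om ^ 2) / s ^ 3.

(** The azimuthal component is the transport of r v_theta = Om, which depends on the cone angle
    alone; only v_alpha can transport it, whence the product of [F] and [o1]. *)
Lemma conical_spherical (th : R) :
  let q := sph rho a th in
  (ex_partials (fun s => px (conical F G Om s)) q /\
   ex_partials (fun s => py (conical F G Om s)) q /\
   ex_partials (fun s => pz (conical F G Om s)) q) /\
  div (conical F G Om) q = (G C / S - f1) / rho ^ 2 /\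
  dot (convect (conical F G Om) q) (e_R a th)
    = - (radial_force C S (F C) (G C) g1 (Om C) / rho ^ 3) /\
  dot (convect (conical F G Om) q) (e_alpha a th)
    = - (polar_force C S (F C) f1 (Om C) / rho ^ 3) /\
  dot (convect (conical F G Om) q) (e_theta a th)
    = - (F C * o1 / (rho ^ 3 * S)).
Proof.
intros q.
assert (Er : meridional_dist q = r) by (now apply meridional_dist_sph).
assert (hq : 0 < px q ^ 2 + py q ^ 2).
{ apply (flow_domain_iff q); now exists rho, a, th. }
pose proof coef_m_r as mr; pose proof coef_m_z as mz; pose proof coef_n_r as nr.
pose proof coef_n_z as nz; pose proof coef_w_r as wr; pose proof coef_w_z as wz.
rewrite <- Er in mr, mz, nr, nz, wr, wz.
unfold conical.
split; [eapply swirl_ex_partials; eassumption|].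
rewrite (swirl_div _ _ _ q _ _ _ _ _ _ hq mr mz nr nz wr wz).
rewrite (swirl_convect _ _ _ q _ _ _ _ _ _ hq mr mz nr nz wr wz).
clear mr mz nr nz wr wz.
rewrite Er.
change (pz q) with z.
replace (px q) with (r * cos th) by reflexivity.
replace (py q) with (r * sin th) by reflexivity.
unfold coef_m, coef_n, coef_w, radial_force, polar_force.
rewrite !x_eq, d_eq.
unfold dot, e_R, e_alpha, e_theta, px, py, pz; simpl fst; simpl snd.
fold S C.
assert (Et := sin_cos_sqr th).
assert (S0 : S <> 0) by lra.
assert (rho0 : rho <> 0) by lra.
generalize (F C) (G C) (Om C); intros F0 G0 O0.
unfold r, z; clear - S_sqr Et S0 rho0.
revert Et; generalize (cos th) (sin th); intros ct st Et.
clearbody S C.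
repeat split; field [S_sqr Et]; auto.
Qed.

End ConicalDerivatives.

(** * The chain rule along coordinate curves *)

Lemma increment_bound (f df : R -> R) (a b l e : R) :
  (forall t, Rmin a b <= t <= Rmax a b ->
     is_derive f t (df t) /\ Rabs (df t - l) <= e) ->
  Rabs (f b - f a - l * (b - a)) <= e * Rabs (b - a).
Proof.
intros h.
destruct (MVT_gen f a b df) as (c & hc & E).
- intros t ht; apply h; lra.
- intros t ht; apply continuity_pt_filterlim.
  apply (ex_derive_continuous f); exists (df t); now apply h.
- replace (_ - _ - _) with ((df c - l) * (b - a)) by lra.
  rewrite Rabs_mult; apply Rmult_le_compat_r; [apply Rabs_pos|now apply h].
Qed.

Lemma between_ball (a b d t : R) :
  Rabs (b - a) < d -> Rmin a b <= t <= Rmax a b -> Rabs (t - a) < d.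
Proof.
unfold Rmin, Rmax; destruct (Rle_dec a b);
intros h ht; apply Rabs_def2 in h; apply Rabs_def1; lra.
Qed.

Lemma ex_partials_Dx (f : vec -> R) (x y z : R) :
  ex_partials f (x, y, z) -> is_derive (fun t : R => f (t, y, z)) x (Dx f (x, y, z)).
Proof. intros (h & _); now apply Derive_correct. Qed.

Lemma ex_partials_Dy (f : vec -> R) (x y z : R) :
  ex_partials f (x, y, z) -> is_derive (fun t : R => f (x, t, z)) y (Dy f (x, y, z)).
Proof. intros (_ & h & _); now apply Derive_correct. Qed.

Lemma ex_partials_Dz (f : vec -> R) (x y z : R) :
  ex_partials f (x, y, z) -> is_derive (fun t : R => f (x, y, t)) z (Dz f (x, y, z)).
Proof. intros (_ & _ & h); now apply Derive_correct. Qed.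

(** The increment is split along three segments parallel to the axes, from (x, y, z) through (x0, y,
    z) and (x0, y0, z) to (x0, y0, z0). Balls of the product space are boxes, so the segments stay
    where the partials are within [e] of their values at [q], and the mean value estimate applies to
    each. *)
Lemma C1_increment (D : vec -> Prop) (f : vec -> R) (q : vec) (e : R) :
  C1_on D f -> D q -> locally q D -> 0 < e ->
  locally q (fun s => Rabs (f s - f q - dot (grad f q) (px s - px q, py s - py q, pz s - pz q))
    <= e * (Rabs (px s - px q) + Rabs (py s - py q) + Rabs (pz s - pz q))).
Proof.
intros hf hq lD he.
destruct (hf q hq) as (_ & cx & cy & cz).
assert (lx := proj1 (filterlim_locally _ _) cx (mkposreal e he)).
assert (ly := proj1 (filterlim_locally _ _) cy (mkposreal e he)).
assert (lz := proj1 (filterlim_locally _ _) cz (mkposreal e he)).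
destruct (filter_and _ _ lD (filter_and _ _ lx (filter_and _ _ ly lz))) as [d hd].
exists d; refine (fun s : vec => _); destruct s as [[x y] z]; intros [[hx hy] hz].
destruct q as [[x0 y0] z0].
change (Rabs (x - x0) < d) in hx; change (Rabs (y - y0) < d) in hy.
change (Rabs (z - z0) < d) in hz.
assert (H : forall u v w, Rabs (u - x0) < d -> Rabs (v - y0) < d -> Rabs (w - z0) < d ->
  ex_partials f (u, v, w) /\
  Rabs (Dx f (u, v, w) - Dx f (x0, y0, z0)) <= e /\
  Rabs (Dy f (u, v, w) - Dy f (x0, y0, z0)) <= e /\
  Rabs (Dz f (u, v, w) - Dz f (x0, y0, z0)) <= e).
{ intros u v w hu hv hw.
  destruct (hd (u, v, w)) as (k & k1 & k2 & k3); [now repeat split|].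
  split; [now apply hf|].
  repeat split; apply Rlt_le; assumption. }
assert (z0d : Rabs (x0 - x0) < d /\ Rabs (y0 - y0) < d).
{ rewrite !Rminus_diag, Rabs_R0; split; apply cond_pos. }
assert (I1 : Rabs (f (x, y, z) - f (x0, y, z) - Dx f (x0, y0, z0) * (x - x0)) <= e * Rabs (x - x0)).
{ apply (increment_bound (fun t => f (t, y, z)) (fun t => Dx f (t, y, z))).
  intros t ht; destruct (H t y z) as (h & h1 & _); try easy;
    [now apply between_ball with x|].
  split; [now apply ex_partials_Dx|easy]. }
assert (I2 : Rabs (f (x0, y, z) - f (x0, y0, z) - Dy f (x0, y0, z0) * (y - y0))
  <= e * Rabs (y - y0)).
{ apply (increment_bound (fun t => f (x0, t, z)) (fun t => Dy f (x0, t, z))).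
  intros t ht; destruct (H x0 t z) as (h & _ & h1 & _); try easy;
    [now apply between_ball with y|].
  split; [now apply ex_partials_Dy|easy]. }
assert (I3 : Rabs (f (x0, y0, z) - f (x0, y0, z0) - Dz f (x0, y0, z0) * (z - z0))
  <= e * Rabs (z - z0)).
{ apply (increment_bound (fun t => f (x0, y0, t)) (fun t => Dz f (x0, y0, t))).
  intros t ht; destruct (H x0 y0 t) as (h & _ & _ & h1); try easy;
    [now apply between_ball with z|].
  split; [now apply ex_partials_Dz|easy]. }
unfold dot, grad, px, py, pz; simpl fst; simpl snd.
apply Rabs_le_between in I1, I2, I3; apply Rabs_le_between; lra.
Qed.

Lemma abs_coord_le_norm (s : vec) :
  Rabs (px s) <= norm s /\ Rabs (py s) <= norm s /\ Rabs (pz s) <= norm s.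
Proof.
destruct s as [[x y] z].
assert (h1 := proj1 (norm_prod (K := R_AbsRing) (x, y) z)).
assert (h2 := proj1 (norm_prod (K := R_AbsRing) x y)).
assert (h3 := Rmax_l (norm (x, y)) (norm z)).
assert (h4 := Rmax_r (norm (x, y)) (norm z)).
assert (h5 := Rmax_l (norm x) (norm y)).
assert (h6 := Rmax_r (norm x) (norm y)).
unfold px, py, pz; simpl fst; simpl snd.
change (Rabs x) with (norm x); change (Rabs y) with (norm y); change (Rabs z) with (norm z).
refine (conj _ (conj _ _)).
- exact (Rle_trans _ _ _ h5 (Rle_trans _ _ _ h2 (Rle_trans _ _ _ h3 h1))).
- exact (Rle_trans _ _ _ h6 (Rle_trans _ _ _ h2 (Rle_trans _ _ _ h3 h1))).
- exact (Rle_trans _ _ _ h4 h1).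
Qed.

Lemma is_linear_dot (v : vec) : is_linear (fun h : vec => dot v h).
Proof.
split.
- intros h k; unfold dot, px, py, pz, plus; simpl; unfold plus; simpl; ring.
- intros l h; unfold dot, px, py, pz, scal; simpl; unfold scal; simpl; unfold mult; simpl; ring.
(* The [+ 1] keeps the bound positive when [v] is zero. *)
- exists (Rabs (px v) + Rabs (py v) + Rabs (pz v) + 1).
  assert (p1 := Rabs_pos (px v)); assert (p2 := Rabs_pos (py v)); assert (p3 := Rabs_pos (pz v)).
  split; [lra|]; intros h.
  destruct (abs_coord_le_norm h) as (h1 & h2 & h3).
  apply (Rmult_le_compat_l _ _ _ p1) in h1.
  apply (Rmult_le_compat_l _ _ _ p2) in h2.
  apply (Rmult_le_compat_l _ _ _ p3) in h3.
  rewrite <- Rabs_mult in h1, h2, h3.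
  change (Rabs (dot v h) <= (Rabs (px v) + Rabs (py v) + Rabs (pz v) + 1) * norm h).
  assert (hn := norm_ge_0 h).
  assert (t1 := Rabs_triang (px v * px h + py v * py h) (pz v * pz h)).
  assert (t2 := Rabs_triang (px v * px h) (py v * py h)).
  unfold dot; lra.
Qed.

Lemma C1_filterdiff (D : vec -> Prop) (f : vec -> R) (q : vec) :
  C1_on D f -> D q -> locally q D ->
  filterdiff f (locally q) (fun h : vec => dot (grad f q) h).
Proof.
intros hf hq lD.
split.
- apply is_linear_dot.
- intros q' hq'.
  assert (Eq := is_filter_lim_locally_unique (K := R_AbsRing) (V := prod_NormedModule R_AbsRing
    (prod_NormedModule R_AbsRing R_NormedModule R_NormedModule) R_NormedModule) q q' hq').
  subst q'.
  intros [e he]; simpl.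
  (* The increment is bounded by a sum of three coordinates, each at most the norm. *)
  assert (he3 : 0 < e / 3) by lra.
  generalize (C1_increment D f q (e / 3) hf hq lD he3); apply filter_imp.
  intros s hs; eapply Rle_trans; [exact hs|].
  destruct (abs_coord_le_norm (minus s q)) as (h1 & h2 & h3).
  change (Rabs (px s - px q) <= norm (minus s q)) in h1.
  change (Rabs (py s - py q) <= norm (minus s q)) in h2.
  change (Rabs (pz s - pz q) <= norm (minus s q)) in h3.
  assert (h : Rabs (px s - px q) + Rabs (py s - py q) + Rabs (pz s - pz q)
    <= 3 * norm (minus s q)) by lra.
  apply Rmult_le_compat_l with (r := e / 3) in h; [|lra].
  eapply Rle_trans; [exact h|].
  right; match goal with |- _ = _ * ?N => change (e / 3 * (3 * N) = e * N) end; field.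
Qed.

Lemma filterdiff_pair {K : AbsRing} {T U V : NormedModule K} (f : T -> U) (g : T -> V) (x : T)
    (lf : T -> U) (lg : T -> V) :
  filterdiff f (locally x) lf -> filterdiff g (locally x) lg ->
  filterdiff (fun t => (f t, g t) : prod_NormedModule K U V) (locally x) (fun t => (lf t, lg t)).
Proof.
intros hf hg.
apply (filterdiff_comp'_2 f g (fun u v => (u, v) : prod_NormedModule K U V) x lf lg
  (fun u v => (u, v) : prod_NormedModule K U V) hf hg).
apply filterdiff_ext with (fun t => t); [now intros []|].
apply filterdiff_ext_lin with (fun t => t); [|now intros []].
apply filterdiff_id.
Qed.

Lemma C1_is_derive_curve (D : vec -> Prop) (f : vec -> R) (x y z : R -> R) (t x' y' z' : R) :
  C1_on D f -> D (x t, y t, z t) -> locally (x t, y t, z t) D ->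
  is_derive x t x' -> is_derive y t y' -> is_derive z t z' ->
  is_derive (fun t => f (x t, y t, z t)) t (dot (grad f (x t, y t, z t)) (x', y', z')).
Proof.
intros hf hq lD hx hy hz.
assert (hp := filterdiff_pair _ _ _ _ _ (filterdiff_pair _ _ _ _ _ hx hy) hz).
assert (hc := filterdiff_comp' _ _ _ _ _ hp (C1_filterdiff D f _ hf hq lD)).
unfold is_derive.
eapply filterdiff_ext_lin; [exact hc|].
intros s; unfold dot, scal, px, py, pz; simpl; unfold mult; simpl; ring.
Qed.

(** * The pressure gradient along the spherical coordinate curves *)

Lemma pressure_radial (p : vec -> R) (rho a th : R) :
  C1_on flow_domain p -> 0 < rho -> 0 < a < PI / 2 ->
  is_derive (fun t => p (sph t a th)) rho (dot (grad p (sph rho a th)) (e_R a th)).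
Proof.
intros hp hrho ha.
assert (hq : flow_domain (sph rho a th)) by (now exists rho, a, th).
apply (C1_is_derive_curve flow_domain p (fun t => t * sin a * cos th)
  (fun t => t * sin a * sin th) (fun t => t * cos a)); auto.
- now apply flow_domain_open.
- auto_derive; [easy|ring].
- auto_derive; [easy|ring].
- auto_derive; [easy|ring].
Qed.

Lemma pressure_polar (p : vec -> R) (rho a th : R) :
  C1_on flow_domain p -> 0 < rho -> 0 < a < PI / 2 ->
  is_derive (fun t => p (sph rho t th)) a (rho * dot (grad p (sph rho a th)) (e_alpha a th)).
Proof.
intros hp hrho ha.
assert (hq : flow_domain (sph rho a th)) by (now exists rho, a, th).
evar_last.
- apply (C1_is_derive_curve flow_domain p (fun t => rho * sin t * cos th)
    (fun t => rho * sin t * sin th) (fun t => rho * cos t) a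
    (rho * cos a * cos th) (rho * cos a * sin th) (- rho * sin a)); auto.
  + now apply flow_domain_open.
  + auto_derive; [easy|ring].
  + auto_derive; [easy|ring].
  + auto_derive; [easy|ring].
- unfold dot, e_alpha, px, py, pz; simpl fst; simpl snd; unfold sph; ring.
Qed.

Lemma pressure_azimuthal (p : vec -> R) (rho a th : R) :
  C1_on flow_domain p -> 0 < rho -> 0 < a < PI / 2 ->
  is_derive (fun t => p (sph rho a t)) th
    (rho * sin a * dot (grad p (sph rho a th)) (e_theta a th)).
Proof.
intros hp hrho ha.
assert (hq : flow_domain (sph rho a th)) by (now exists rho, a, th).
evar_last.
- apply (C1_is_derive_curve flow_domain p (fun t => rho * sin a * cos t)
    (fun t => rho * sin a * sin t) (fun t => rho * cos a) th
    (- rho * sin a * sin th) (rho * sin a * cos th) 0); auto.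
  + now apply flow_domain_open.
  + auto_derive; [easy|ring].
  + auto_derive; [easy|ring].
  + auto_derive; [easy|ring].
- unfold dot, e_theta, px, py, pz; simpl fst; simpl snd; unfold sph; ring.
Qed.

(** * Necessity *)

Lemma is_derive_zero_eq (f : R -> R) (x y : R) :
  (forall t, Rmin x y <= t <= Rmax x y -> is_derive f t 0) -> f x = f y.
Proof.
intros h.
assert (E : Rabs (f y - f x - 0 * (y - x)) <= 0 * Rabs (y - x)).
{ apply (increment_bound f (fun _ => 0)); intros t ht; split; [now apply h|].
  rewrite Rminus_diag, Rabs_R0; lra. }
rewrite !Rmult_0_l in E; apply Rabs_le_between in E; lra.
Qed.

Lemma is_derive_zero_const_01 (f : R -> R) :
  (forall t, 0 < t < 1 -> is_derive f t 0) ->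
  forall x y, 0 < x < 1 -> 0 < y < 1 -> f x = f y.
Proof.
intros h x y hx hy; apply is_derive_zero_eq; intros t ht; apply h.
revert ht; unfold Rmin, Rmax; destruct (Rle_dec x y); lra.
Qed.

Lemma is_derive_eq (f : R -> R) (x l m : R) : is_derive f x l -> is_derive f x m -> l = m.
Proof.
intros hl hm; rewrite <- (is_derive_unique _ _ _ hl); now apply is_derive_unique.
Qed.

Lemma locally_01 (x : R) : 0 < x < 1 -> locally x (fun t => 0 < t < 1).
Proof. intros hx; apply (open_and _ _ (open_gt 0) (open_lt 1)); exact hx. Qed.

Lemma is_derive_sqr (f : R -> R) (x l : R) :
  is_derive f x l -> is_derive (fun t => f t ^ 2) x (2 * f x * l).
Proof.
intros h; evar_last; [exact (is_derive_pow f 2 x l h)|]; simpl; ring.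
Qed.

(** If c is nonzero then [f] has no zero, and 2 f f' = 0 forces f' = 0; if c is zero then so is [f].
    A square root chosen separately at each point is thus ruled out. *)
Lemma sqr_const_01 (f : R -> R) (c : R) :
  (forall x, 0 < x < 1 -> ex_derive f x) -> (forall x, 0 < x < 1 -> f x ^ 2 = c) ->
  forall x y, 0 < x < 1 -> 0 < y < 1 -> f x = f y.
Proof.
intros hd hc.
destruct (Req_dec c 0) as [c0|c0].
- intros x y hx hy; transitivity 0; [|symmetry]; apply Rsqr_0_uniq; rewrite Rsqr_pow2, hc; easy.
- apply is_derive_zero_const_01; intros t ht.
  destruct (hd t ht) as [l hl].
  assert (h0 : is_derive (fun t => f t ^ 2) t 0).
  { apply is_derive_ext_loc with (fun _ => c); [|exact (is_derive_const c t)].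
    generalize (locally_01 t ht); apply filter_imp; intros s hs; now rewrite hc. }
  assert (E := is_derive_eq _ _ _ _ h0 (is_derive_sqr f t l hl)).
  assert (h := hc t ht).
  assert (l0 : l = 0).
  { symmetry in E; destruct (Rmult_integral _ _ E) as [E'|E']; [|exact E'].
    destruct c0; rewrite <- h; replace (f t) with 0 by lra; ring. }
  now rewrite <- l0.
Qed.

Lemma const_01_limit {F : (R -> Prop) -> Prop} {FF : ProperFilter F} (f : R -> R) (l : R) :
  F (fun t => 0 < t < 1) -> (forall x y, 0 < x < 1 -> 0 < y < 1 -> f x = f y) ->
  filterlim f F (locally l) -> forall x, 0 < x < 1 -> f x = l.
Proof.
intros hF hf hl x hx.
apply (filterlim_locally_unique (F := F) f); [|exact hl].
apply filterlim_ext_loc with (fun _ => f x); [|apply filterlim_const].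
revert hF; apply filter_imp; intros t ht; now apply hf.
Qed.

Lemma at_left_1_01 : at_left 1 (fun t => 0 < t < 1).
Proof.
generalize (open_gt 0 1 Rlt_0_1); unfold at_left, within; apply filter_imp.
intros t h1 h2; split; easy.
Qed.

Lemma at_right_0_01 : at_right 0 (fun t => 0 < t < 1).
Proof.
generalize (open_lt 1 0 Rlt_0_1); unfold at_right, within; apply filter_imp.
intros t h1 h2; split; easy.
Qed.

Lemma sph_2PI (rho a : R) : sph rho a (2 * PI) = sph rho a 0.
Proof. unfold sph; now rewrite cos_2PI, sin_2PI, cos_0, sin_0. Qed.

Lemma sqrt_1_minus_cos2 (a : R) : 0 < a < PI / 2 -> sqrt (1 - cos a ^ 2) = sin a.
Proof.
intros ha; rewrite <- sin_cos_sqr; apply sqrt_pow2.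
apply Rlt_le, (sin_cos_pos _ ha).
Qed.

(** * Ordinary differential equations for the profiles, and their integration *)

Section Necessity.

Variables (F F1 F2 F3 G G1 Om O1 : R -> R) (p : vec -> R).
Hypothesis DF : forall x, 0 < x < 1 -> is_derive F x (F1 x).
Hypothesis DF1 : forall x, 0 < x < 1 -> is_derive F1 x (F2 x).
Hypothesis DF2 : forall x, 0 < x < 1 -> is_derive F2 x (F3 x).
Hypothesis DG : forall x, 0 < x < 1 -> is_derive G x (G1 x).
Hypothesis DOm : forall x, 0 < x < 1 -> is_derive Om x (O1 x).
Hypothesis O1_cont : forall x, 0 < x < 1 -> continuous O1 x.
Hypothesis p_C1 : C1_on flow_domain p.
Hypothesis euler : steady_euler flow_domain (conical F G Om) p.

Let A a := radial_force (cos a) (sin a) (F (cos a)) (G (cos a)) (G1 (cos a)) (Om (cos a)).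
Let B a := polar_force (cos a) (sin a) (F (cos a)) (F1 (cos a)) (Om (cos a)).

Lemma spherical_euler (rho a th : R) :
  0 < rho -> 0 < a < PI / 2 ->
  let q := sph rho a th in
  G (cos a) = sin a * F1 (cos a) /\
  dot (grad p q) (e_R a th) = A a / rho ^ 3 /\
  dot (grad p q) (e_alpha a th) = B a / rho ^ 3 /\
  dot (grad p q) (e_theta a th) = F (cos a) * O1 (cos a) / (rho ^ 3 * sin a).
Proof.
intros hrho ha q.
destruct (sin_cos_pos _ ha) as [hs hc].
destruct (euler q) as (_ & _ & _ & ec & ed); [now exists rho, a, th|].
destruct (conical_spherical F G Om rho a _ _ _ hrho ha (DF _ hc) (DG _ hc) (DOm _ hc) th)
  as (_ & h0 & h1 & h2 & h3).
fold q in h0, h1, h2, h3; rewrite ec in h1, h2, h3; rewrite ed in h0.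
assert (N : forall v, dot (- Dx p q, - Dy p q, - Dz p q) v = - dot (grad p q) v)
  by (intros v; unfold dot, grad, px, py, pz; simpl; ring).
rewrite N in h1, h2, h3.
split.
- assert (E : G (cos a) / sin a - F1 (cos a) = 0).
  { apply Rmult_eq_reg_r with (/ rho ^ 2); [rewrite Rmult_0_l; symmetry; exact h0|].
    apply Rinv_neq_0_compat, pow_nonzero; lra. }
  apply Rminus_diag_uniq in E; rewrite <- E; field; lra.
- unfold A, B; repeat split; lra.
Qed.

(* Integrating the azimuthal pressure gradient over a full circle gives zero. *)
Lemma F_O1_eq0 (x : R) : 0 < x < 1 -> F x * O1 x = 0.
Proof.
intros hx; destruct (cos_surj_01 x hx) as (a & ha & <-).
destruct (sin_cos_pos _ ha) as [hs hc].
set (c := F (cos a) * O1 (cos a)).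
(* At radius 1 the factor sin a of the circle's speed cancels the one in the azimuthal gradient, so
   the pressure has the constant slope [c] in the meridian angle. *)
assert (D : forall t, is_derive (fun t => p (sph 1 a t) - c * t) t 0).
{ intros t; evar_last.
  - eapply (is_derive_minus (fun t => p (sph 1 a t)) (fun t => c * t) t _ c).
    + apply pressure_azimuthal; [exact p_C1|lra|exact ha].
    + auto_derive; [easy|ring].
  - destruct (spherical_euler 1 a t) as (_ & _ & _ & ->); [lra|exact ha|].
    unfold minus, plus, opp; simpl; unfold c; field; lra. }
assert (E := is_derive_zero_eq _ 0 (2 * PI) (fun t _ => D t)); simpl in E.
rewrite sph_2PI in E; assert (hpi := PI_RGT_0); nra.
Qed.

(* Cross-differentiation without second derivatives of the pressure: integrating
   [A a / rho ^ 3] over [1 <= rho <= 2] gives [3 / 8 * A a]. *)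
Lemma radial_polar_compat (a : R) : 0 < a < PI / 2 -> is_derive A a (- 2 * B a).
Proof.
intros ha.
assert (E : forall b, 0 < b < PI / 2 -> p (sph 2 b 0) - p (sph 1 b 0) = 3 / 8 * A b).
{ intros b hb.
  assert (D : p (sph 1 b 0) + A b / (2 * 1 ^ 2) = p (sph 2 b 0) + A b / (2 * 2 ^ 2)).
  { apply (is_derive_zero_eq (fun t => p (sph t b 0) + A b / (2 * t ^ 2)) 1 2).
    intros t ht; rewrite Rmin_left, Rmax_right in ht by lra.
    evar_last.
    - eapply (is_derive_plus (fun t => p (sph t b 0)) (fun t => A b / (2 * t ^ 2)) t _
        (- (A b / t ^ 3))).
      + apply pressure_radial; [exact p_C1|lra|exact hb].
      + auto_derive; [|field; lra].
        apply Rmult_integral_contrapositive_currified; [lra|].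
        apply Rmult_integral_contrapositive_currified; lra.
    - destruct (spherical_euler t b 0) as (_ & -> & _); [lra|exact hb|].
      unfold plus; simpl; ring. }
  lra. }
assert (l : locally a (fun b => 0 < b < PI / 2))
  by (apply (open_and _ _ (open_gt 0) (open_lt (PI / 2))); exact ha).
apply is_derive_ext_loc with (fun b => 8 / 3 * (p (sph 2 b 0) - p (sph 1 b 0))).
{ revert l; apply filter_imp; intros b hb; rewrite E by easy.
  match goal with |- ?u = ?v => change (@eq R u v) end; field. }
evar_last.
- eapply is_derive_scal, (is_derive_minus (fun b => p (sph 2 b 0)) (fun b => p (sph 1 b 0)));
  apply pressure_polar; (exact p_C1 || exact ha || lra).
- destruct (spherical_euler 1 a 0) as (_ & _ & h1 & _); [lra|exact ha|].
  destruct (spherical_euler 2 a 0) as (_ & _ & h2 & _); [lra|exact ha|].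
  (* The polar derivative at radius rho is B / rho^2, and 8/3 (B / 4 - B) = - 2 B. *)
  rewrite h1, h2; unfold scal, minus, plus, opp; simpl; unfold mult; simpl; field.
Qed.

Lemma div_free_G (x : R) : 0 < x < 1 -> G x = sqrt (1 - x ^ 2) * F1 x.
Proof.
intros hx; destruct (cos_surj_01 x hx) as (a & ha & <-).
rewrite sqrt_1_minus_cos2 by easy.
now apply (spherical_euler 1 a 0); [lra|].
Qed.

Lemma is_derive_sqrt_mult (f : R -> R) (f' x : R) :
  0 < x < 1 -> is_derive f x f' ->
  is_derive (fun t => sqrt (1 - t ^ 2) * f t) x
    (sqrt (1 - x ^ 2) * f' - x / sqrt (1 - x ^ 2) * f x).
Proof.
intros hx hf.
assert (h : 0 < 1 - x ^ 2) by nra.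
assert (hs := sqrt_lt_R0 _ h).
evar_last.
- eapply (is_derive_mult (fun t => sqrt (1 - t ^ 2)) f x (- x / sqrt (1 - x ^ 2)) f');
    [|exact hf|exact Rmult_comm].
  auto_derive; simpl in *; [lra|].
  unfold Rminus in *; field; lra.
- unfold plus, mult; simpl; field; simpl in *; lra.
Qed.

Lemma div_free_G1 (x : R) :
  0 < x < 1 -> G1 x = sqrt (1 - x ^ 2) * F2 x - x / sqrt (1 - x ^ 2) * F1 x.
Proof.
intros hx; apply (is_derive_eq G x); [now apply DG|].
apply is_derive_ext_loc with (fun t => sqrt (1 - t ^ 2) * F1 t).
- generalize (locally_01 x hx); apply filter_imp; intros t ht; symmetry; now apply div_free_G.
- apply is_derive_sqrt_mult; auto.
Qed.

(** Let H = F^2. Eliminating [G] gives A a = [Phi (cos a)] with Phi = H''/2 + (H + Om^2) / (1 -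
    x^2). In Phi' the terms H' / (1 - x^2) and 2 x (H + Om^2) / (1 - x^2)^2 add up to exactly 2 B /
    sin a, so the compatibility relation removes them and leaves H'''/2 and the derivative of
    Om^2. *)
Lemma third_order_eq (x : R) :
  0 < x < 1 -> (3 * F1 x * F2 x + F x * F3 x) * (1 - x ^ 2) + 2 * Om x * O1 x = 0.
Proof.
intros hx; destruct (cos_surj_01 x hx) as (a & ha & <-).
destruct (sin_cos_pos _ ha) as [hs hc].
pose (Phi := fun x => F1 x ^ 2 + F x * F2 x + (F x ^ 2 + Om x ^ 2) / (1 - x ^ 2)).
pose (Phi' := fun x => 3 * F1 x * F2 x + F x * F3 x
    + (2 * F x * F1 x + 2 * Om x * O1 x) / (1 - x ^ 2)
    + 2 * x * (F x ^ 2 + Om x ^ 2) / (1 - x ^ 2) ^ 2).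
assert (EA : forall b, 0 < b < PI / 2 -> Phi (cos b) = A b).
{ intros b hb; destruct (sin_cos_pos _ hb) as [hsb hcb].
  unfold A, radial_force, Phi.
  rewrite div_free_G1, div_free_G, sqrt_1_minus_cos2, <- sin_cos_sqr by easy.
  field [(sin_cos_sqr b)]; lra. }
assert (x2 : 1 - cos a ^ 2 <> 0) by nra.
assert (D1 : is_derive Phi (cos a) (Phi' (cos a))).
{ assert (d0 := DF _ hc); assert (d1 := DF1 _ hc); assert (d2 := DF2 _ hc).
  assert (d3 := DOm _ hc).
  assert (e0 := is_derive_unique _ _ _ d0); assert (e1 := is_derive_unique _ _ _ d1).
  assert (e2 := is_derive_unique _ _ _ d2); assert (e3 := is_derive_unique _ _ _ d3).
  unfold Phi; evar_last.
  - auto_derive; [|reflexivity].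
    repeat split; try (eexists; eassumption); exact x2.
  - change (fun x => F x) with F; change (fun x => F1 x) with F1.
    change (fun x => F2 x) with F2; change (fun x => Om x) with Om.
    rewrite e0, e1, e2, e3; unfold Phi'; field; exact x2. }
assert (D2 : is_derive A a (- sin a * Phi' (cos a))).
{ apply is_derive_ext_loc with (fun b => Phi (cos b)).
  - assert (l : locally a (fun b => 0 < b < PI / 2))
      by (apply (open_and _ _ (open_gt 0) (open_lt (PI / 2))); exact ha).
    revert l; apply filter_imp; exact EA.
  - eapply (is_derive_comp Phi cos a _ (- sin a) D1).
    auto_derive; [easy|ring]. }
assert (E := is_derive_eq _ _ _ _ D2 (radial_polar_compat a ha)).
unfold B, polar_force, Phi' in E; rewrite <- sin_cos_sqr in E |- *.
(* [u] stands for H'''/2 and [v] for 2 Om Om'; keeping them abstract makes clearing denominators a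
   small identity. *)
assert (K : forall u v, - sin a * (u + (2 * F (cos a) * F1 (cos a) + v) / sin a ^ 2
    + 2 * cos a * (F (cos a) ^ 2 + Om (cos a) ^ 2) / (sin a ^ 2) ^ 2)
  = - 2 * (F (cos a) * F1 (cos a) / sin a + cos a * (F (cos a) ^ 2 + Om (cos a) ^ 2) / sin a ^ 3)
  -> u * sin a ^ 2 + v = 0).
{ intros u v h.
  apply Rmult_eq_reg_l with (- / sin a); [|apply Ropp_neq_0_compat, Rinv_neq_0_compat; lra].
  rewrite Rmult_0_r; apply Rminus_diag_eq in h; rewrite <- h; field; lra. }
exact (K _ _ E).
Qed.

Lemma Om_O1_eq0 (x : R) : 0 < x < 1 -> Om x * O1 x = 0.
Proof.
intros hx.
destruct (Req_dec (O1 x) 0) as [->|hO]; [ring|].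
assert (l : locally x (fun t => F t = 0)).
{ assert (l1 : locally x (fun t => O1 t <> 0))
    by (exact (O1_cont x hx _ (open_neq 0 _ hO))).
  generalize (filter_and _ _ (locally_01 x hx) l1); apply filter_imp.
  intros t [ht hn]; destruct (Rmult_integral _ _ (F_O1_eq0 t ht)) as [h|h]; easy. }
assert (F1x : F1 x = 0).
{ apply (is_derive_eq F x); [now apply DF|].
  apply is_derive_ext_loc with (fun _ => 0); [|exact (is_derive_const 0 x)].
  revert l; apply filter_imp; easy. }
assert (Fx := locally_singleton _ _ l).
(* Each term of the equation in [F] carries a factor [F x] or [F1 x], so these two zeros suffice. *)
assert (E := third_order_eq x hx); rewrite Fx, F1x in E; lra.
Qed.

Lemma Om_eq_Comega (Comega : R) :
  Comega <> 0 -> filterlim Om (at_left 1) (locally Comega) ->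
  forall x, 0 < x < 1 -> Om x = Comega.
Proof.
intros hC hl.
(* Om Om' = 0 controls the square alone; the limit at 1 fixes its value, and [sqr_const_01] then
   removes the sign ambiguity. *)
assert (h2 : forall x, 0 < x < 1 -> Om x ^ 2 = Comega ^ 2).
{ apply (const_01_limit (F := at_left 1)); [exact at_left_1_01| |].
  - apply is_derive_zero_const_01; intros t ht; evar_last;
      [exact (is_derive_sqr _ _ _ (DOm t ht))|].
    rewrite Rmult_assoc, Om_O1_eq0 by easy; simpl; ring.
  - apply (filterlim_comp _ _ _ Om (fun t => t ^ 2) (at_left 1) (locally Comega)); [exact hl|].
    exact (continuous_pow (fun t : R => t) 2 Comega (continuous_id Comega)). }
apply (const_01_limit (F := at_left 1)); [exact at_left_1_01| |exact hl].
apply sqr_const_01 with (Comega ^ 2); [|exact h2].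
intros x hx; exists (O1 x); now apply DOm.
Qed.

Lemma F_sqr_quadratic :
  filterlim F (at_right 0) (locally 0) -> filterlim F (at_left 1) (locally 0) ->
  exists c, forall x, 0 < x < 1 -> F x ^ 2 = c * (x * (1 - x)).
Proof.
intros l0 l1.
assert (h12 : 0 < 1 / 2 < 1) by lra.
assert (Z : forall x, 0 < x < 1 -> 3 * F1 x * F2 x + F x * F3 x = 0).
{ intros x hx; assert (E := third_order_eq x hx).
  assert (E' := Om_O1_eq0 x hx).
  assert (x2 : 1 - x ^ 2 <> 0) by nra.
  apply Rmult_eq_reg_r with (1 - x ^ 2); [lra|exact x2]. }
(* With H = F^2, [Z] says H''' = 0, which is integrated three times: [K2] is H''/2 = - c, [K1] is
   H'/2 + c x = k, and [K0] makes H + c x^2 - 2 k x constant. The point 1/2 serves to name the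
   constants. *)
pose (c := - (F1 (1 / 2) ^ 2 + F (1 / 2) * F2 (1 / 2))).
assert (K2 : forall x, 0 < x < 1 -> F1 x ^ 2 + F x * F2 x = - c).
{ intros x hx; unfold c; rewrite Ropp_involutive.
  apply (is_derive_zero_const_01 (fun x => F1 x ^ 2 + F x * F2 x)); [|exact hx|exact h12].
  intros t ht; evar_last.
  - eapply (is_derive_plus (fun x => F1 x ^ 2) (fun x => F x * F2 x)).
    + exact (is_derive_sqr _ _ _ (DF1 t ht)).
    + exact (is_derive_mult F F2 _ _ _ (DF t ht) (DF2 t ht) Rmult_comm).
  - unfold plus, mult; simpl; rewrite <- (Z t ht); ring. }
pose (k := F (1 / 2) * F1 (1 / 2) + c * (1 / 2)).
assert (K1 : forall x, 0 < x < 1 -> F x * F1 x + c * x = k).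
{ intros x hx.
  apply (is_derive_zero_const_01 (fun x => F x * F1 x + c * x)); [|exact hx|exact h12].
  intros t ht; evar_last.
  - eapply (is_derive_plus (fun x => F x * F1 x) (fun x => c * x) t _ c).
    + exact (is_derive_mult F F1 _ _ _ (DF t ht) (DF1 t ht) Rmult_comm).
    + auto_derive; [easy|ring].
  - assert (E := K2 t ht); unfold plus, mult; simpl; nra. }
pose (g := fun x => F x ^ 2 + (c * x ^ 2 - 2 * k * x)).
assert (K0 : forall x y, 0 < x < 1 -> 0 < y < 1 -> g x = g y).
{ apply is_derive_zero_const_01; intros t ht; unfold g; evar_last.
  - eapply (is_derive_plus (fun x => F x ^ 2) (fun x => c * x ^ 2 - 2 * k * x) t _
      (2 * c * t - 2 * k)).
    + exact (is_derive_sqr _ _ _ (DF t ht)).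
    + auto_derive; [easy|ring].
  - assert (E := K1 t ht); unfold plus; simpl; lra. }
assert (L : forall (Fl : (R -> Prop) -> Prop) y, Filter Fl ->
  filterlim F Fl (locally 0) -> filterlim (fun t => t) Fl (locally y) ->
  filterlim g Fl (locally (c * y ^ 2 - 2 * k * y))).
{ intros Fl y FFl hF hy.
  replace (c * y ^ 2 - 2 * k * y) with (0 ^ 2 + (c * y ^ 2 - 2 * k * y)) by ring.
  apply (filterlim_comp_2 (G := locally (0 ^ 2)) (H := locally (c * y ^ 2 - 2 * k * y))).
  - apply (filterlim_comp _ _ _ F (fun t => t ^ 2) Fl (locally 0)); [exact hF|].
    exact (continuous_pow (fun t : R => t) 2 0 (continuous_id 0)).
  - apply (filterlim_comp _ _ _ (fun t => t) (fun y => c * y ^ 2 - 2 * k * y) Fl (locally y));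
      [exact hy|].
    apply (ex_derive_continuous (fun y => c * y ^ 2 - 2 * k * y)); auto_derive; easy.
  - apply (filterlim_plus (V := R_NormedModule)). }
assert (L0 : forall x, 0 < x < 1 -> g x = c * 0 ^ 2 - 2 * k * 0).
{ apply (const_01_limit (F := at_right 0)); [exact at_right_0_01|exact K0|].
  apply L; [apply filter_filter|exact l0|].
  intros P hP; exact (filter_imp _ _ (fun t ht _ => ht) hP). }
assert (L1 : forall x, 0 < x < 1 -> g x = c * 1 ^ 2 - 2 * k * 1).
{ apply (const_01_limit (F := at_left 1)); [exact at_left_1_01|exact K0|].
  apply L; [apply filter_filter|exact l1|].
  intros P hP; exact (filter_imp _ _ (fun t ht _ => ht) hP). }
exists c; intros x hx.
assert (E0 := L0 x hx); assert (E1 := L1 x hx); unfold g in E0, E1.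
(* The constant value of [g] is 0 by the limit at 0 and c - 2 k by the limit at 1. *)
assert (Ek : 2 * k = c) by lra.
rewrite Ek in E0; lra.
Qed.

(** The quotient [K] of [F] by the positive root sqrt (x (1 - x)) is differentiable with constant
    square, hence constant; its value is the sought coefficient, sign included. *)
Lemma F_closed_form :
  filterlim F (at_right 0) (locally 0) -> filterlim F (at_left 1) (locally 0) ->
  exists c, forall x, 0 < x < 1 -> F x = c * sqrt (x * (1 - x)).
Proof.
intros l0 l1; destruct (F_sqr_quadratic l0 l1) as [c hc].
pose (K := fun x => F x / sqrt (x * (1 - x))).
assert (hw : forall x, 0 < x < 1 -> 0 < x * (1 - x)) by (intros x hx; nra).
assert (hK : forall x y, 0 < x < 1 -> 0 < y < 1 -> K x = K y).
{ apply sqr_const_01 with c; intros x hx; assert (h := hw x hx); assert (hs := sqrt_lt_R0 _ h).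
  - unfold K; auto_derive; change (1 + - x) with (1 - x).
    repeat split; [exists (F1 x); now apply DF|exact h|lra].
  - unfold K, Rdiv; rewrite Rpow_mult_distr, pow_inv, pow2_sqrt, hc by lra; field; nra. }
exists (K (1 / 2)); intros x hx.
rewrite (hK (1 / 2) x) by lra.
assert (hs := sqrt_lt_R0 _ (hw x hx)).
unfold K; field; lra.
Qed.

End Necessity.

(** * Sufficiency *)

(** [d] lists candidate derivatives. As [f] is prescribed on (0, 1) only, each [Derive_n] is
    identified with its candidate through neighbourhoods inside the interval; continuity of the last
    one comes from its differentiability. *)
Lemma Cn_01_intro (n : nat) (f : R -> R) (d : nat -> R -> R) :
  (forall x, 0 < x < 1 -> f x = d 0%nat x) ->
  (forall k x, (k < n)%nat -> 0 < x < 1 -> is_derive (d k) x (d (S k) x)) ->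
  (forall x, 0 < x < 1 -> ex_derive (d n) x) ->
  Cn_01 n f.
Proof.
intros h0 hd hn.
assert (E : forall k x, (k <= n)%nat -> 0 < x < 1 -> Derive_n f k x = d k x).
{ induction k as [|k IH]; intros x hk hx; [now apply h0|].
  simpl; apply is_derive_unique.
  apply is_derive_ext_loc with (d k); [|apply hd; [lia|exact hx]].
  generalize (locally_01 x hx); apply filter_imp; intros t ht; symmetry; apply IH; [lia|exact ht]. }
assert (X : forall k x, (k <= n)%nat -> 0 < x < 1 -> ex_derive (d k) x).
{ intros k x hk hx; destruct (proj1 (Nat.lt_eq_cases k n) hk) as [h| ->]; [|now apply hn].
  eexists; now apply hd. }
assert (X' : forall k x, (k <= n)%nat -> 0 < x < 1 -> ex_derive (Derive_n f k) x).
{ intros k x hk hx; apply ex_derive_ext_loc with (d k); [|now apply X].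
  generalize (locally_01 x hx); apply filter_imp; intros t ht; symmetry; now apply E. }
intros k x hk hx; split.
(* [ex_derive_n f 0 x] is [True] by definition, and order [S k] means differentiability of the
   derivative of order [k]. *)
- destruct k as [|k]; [exact I|]; apply X'; [lia|exact hx].
- apply (ex_derive_continuous (Derive_n f k)); now apply X'.
Qed.

(** * The closed forms and their derivatives *)

Section Sufficiency.

Variables C1 Comega : R.

Let s x := sqrt (x * (1 - x)).
Let F0 x := C1 * s x.
Let F1 x := C1 * (1 - 2 * x) / (2 * s x).
Let F2 x := - C1 / (4 * (x * (1 - x)) * s x).
Let F3 x := 3 * C1 * (1 - 2 * x) / (8 * (x * (1 - x)) ^ 2 * s x).
Let r x := sqrt (1 - x ^ 2).
Let G0 x := r x * F1 x.
Let G1 x := r x * F2 x - x / r x * F1 x.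
Let G2 x := r x * F3 x - 2 * x / r x * F2 x - F1 x / r x ^ 3.

Lemma w_pos (x : R) : 0 < x < 1 -> 0 < x * (1 - x).
Proof. intros hx; nra. Qed.

Let s_pos (x : R) : 0 < x < 1 -> 0 < s x.
Proof. intros hx; now apply sqrt_lt_R0, w_pos. Qed.

Let s_sqr (x : R) : 0 < x < 1 -> s x ^ 2 = x * (1 - x).
Proof. intros hx; apply pow2_sqrt, Rlt_le, w_pos, hx. Qed.

Let r_pos (x : R) : 0 < x < 1 -> 0 < r x.
Proof. intros hx; apply sqrt_lt_R0; nra. Qed.

Let r_sqr (x : R) : 0 < x < 1 -> r x ^ 2 = 1 - x ^ 2.
Proof. intros hx; apply pow2_sqrt; nra. Qed.

Let Ds (x : R) : 0 < x < 1 -> is_derive s x ((1 - 2 * x) / (2 * s x)).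
Proof.
intros hx; assert (h := s_pos x hx); assert (hw := w_pos x hx).
unfold s in *; auto_derive; change (1 + - x) with (1 - x); [exact hw|field; lra].
Qed.

Let Dr (x : R) : 0 < x < 1 -> is_derive r x (- x / r x).
Proof.
intros hx; assert (h := r_pos x hx).
unfold r in *; auto_derive; change (1 + - (x * (x * 1))) with (1 - x ^ 2); [nra|field; lra].
Qed.

Lemma is_derive_closed_form_F (x : R) : 0 < x < 1 -> is_derive F0 x (F1 x).
Proof.
intros hx; assert (h := s_pos x hx); assert (d := Ds x hx).
assert (e := is_derive_unique _ _ _ d).
unfold F0, F1; clearbody s; auto_derive; [eexists; exact d|].
change (fun x => s x) with s; rewrite e; field; lra.
Qed.

(** The numerator collapses because 4 s^2 + (1 - 2 x)^2 = 1. *)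
Let DF1 (x : R) : 0 < x < 1 -> is_derive F1 x (F2 x).
Proof.
intros hx; assert (h := s_pos x hx); assert (d := Ds x hx).
assert (e := is_derive_unique _ _ _ d); assert (h2 := s_sqr x hx).
unfold F1, F2; clear F0 F1 F2 F3 G0 G1 G2; clearbody s.
rewrite <- h2.
auto_derive; [repeat split; [eexists; exact d|lra]|].
change (fun x => s x) with s; rewrite e; field_simplify_eq; [|lra].
replace (s x ^ 3) with (s x * s x ^ 2) by ring; rewrite h2; ring.
Qed.

Let DF2 (x : R) : 0 < x < 1 -> is_derive F2 x (F3 x).
Proof.
intros hx; assert (h := s_pos x hx); assert (d := Ds x hx); assert (hw := w_pos x hx).
assert (e := is_derive_unique _ _ _ d); assert (h2 := s_sqr x hx).
unfold F2, F3; clear F0 F1 F2 F3 G0 G1 G2 DF1; clearbody s.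
auto_derive; change (1 + - x) with (1 - x).
- repeat split; [eexists; exact d|].
  apply Rgt_not_eq; repeat apply Rmult_lt_0_compat; lra.
- change (fun x => s x) with s; rewrite e; field_simplify_eq; [|repeat split; lra].
  replace (s x ^ 4) with (s x ^ 2 * s x ^ 2) by ring; rewrite h2; ring.
Qed.

Let DG0 (x : R) : 0 < x < 1 -> is_derive G0 x (G1 x).
Proof. intros hx; apply is_derive_sqrt_mult; auto. Qed.

(** The coefficient of [F1] comes from (x / r)' = 1 / r^3, as r^2 + x^2 = 1. *)
Let DG1 (x : R) : 0 < x < 1 -> is_derive G1 x (G2 x).
Proof.
intros hx; assert (h := r_pos x hx); assert (d := Dr x hx).
assert (d1 := DF1 x hx); assert (d2 := DF2 x hx); assert (h2 := r_sqr x hx).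
assert (e := is_derive_unique _ _ _ d); assert (e1 := is_derive_unique _ _ _ d1).
assert (e2 := is_derive_unique _ _ _ d2).
unfold G1, G2; clear G0 G1 G2 DG0; clearbody r F1 F2 F3.
auto_derive; [repeat split; try (eexists; eassumption); lra|].
change (fun x => r x) with r; change (fun x => F1 x) with F1; change (fun x => F2 x) with F2.
rewrite e, e1, e2; field_simplify_eq; [|lra].
replace (r x ^ 4) with (r x ^ 2 * r x ^ 2) by ring; rewrite ?h2; ring.
Qed.

Let F3_ex_derive (x : R) : 0 < x < 1 -> ex_derive F3 x.
Proof.
intros hx; assert (h := s_pos x hx); assert (d := Ds x hx); assert (hw := w_pos x hx).
unfold F3; clearbody s; auto_derive; change (1 + - x) with (1 - x).
repeat split; [eexists; exact d|].
apply Rgt_not_eq; repeat apply Rmult_lt_0_compat; lra.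
Qed.

Let G2_ex_derive (x : R) : 0 < x < 1 -> ex_derive G2 x.
Proof.
intros hx; assert (h := r_pos x hx); assert (d := Dr x hx).
assert (d1 := DF1 x hx); assert (d2 := DF2 x hx); assert (d3 := F3_ex_derive x hx).
unfold G2; clearbody r F1 F2 F3; auto_derive; repeat split; try (eexists; eassumption); try lra.
- exact d3.
- apply Rgt_not_eq; repeat apply Rmult_lt_0_compat; lra.
Qed.

(** A factor sqrt (1 - x) cancels between sqrt (1 - x^2) and sqrt (x (1 - x)). *)
Lemma closed_form_G (x : R) :
  0 < x < 1 -> C1 * (((1 - 2 * x) * sqrt (1 + x)) / (2 * sqrt x)) = G0 x.
Proof.
intros hx; unfold G0, F1, s, r.
replace (1 - x ^ 2) with ((1 - x) * (1 + x)) by ring.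
rewrite !sqrt_mult by lra.
assert (h1 := sqrt_lt_R0 x (proj1 hx)).
assert (h2 : 0 < sqrt (1 - x)) by (apply sqrt_lt_R0; lra).
field; lra.
Qed.

Variables F G Om : R -> R.
Hypothesis F_def : forall x, 0 < x < 1 -> F x = F0 x.
Hypothesis G_def : forall x, 0 < x < 1 -> G x = G0 x.
Hypothesis Om_def : forall x, 0 < x < 1 -> Om x = Comega.

Lemma Cn_closed_form_F : Cn_01 3 F.
Proof.
apply (Cn_01_intro 3 F
  (fun k => match k with O => F0 | S O => F1 | S (S O) => F2 | _ => F3 end)); auto.
intros [|[|[|k]]] x hk hx; auto using is_derive_closed_form_F; lia.
Qed.

Lemma Cn_closed_form_G : Cn_01 2 G.
Proof.
apply (Cn_01_intro 2 G (fun k => match k with O => G0 | S O => G1 | _ => G2 end)); auto.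
intros [|[|k]] x hk hx; auto; lia.
Qed.

Lemma Cn_const_Om : Cn_01 1 Om.
Proof.
apply (Cn_01_intro 1 Om (fun k => match k with O => fun _ => Comega | _ => fun _ => 0 end)); auto.
- intros [|k] x hk hx; [|lia]; apply is_derive_Rconst.
- intros x hx; exists 0; apply is_derive_Rconst.
Qed.

(** * The explicit pressure *)

Let N (q : vec) := sqrt (px q ^ 2 + py q ^ 2 + pz q ^ 2).
Let k (q : vec) := px q ^ 2 + py q ^ 2.
(** The radial equation dp/dR = A / R^3 integrates to - A / (2 R^2), and for the closed forms A = -
    C1^2 / (1 + x) + Comega^2 / (1 - x^2). *)
Let p (q : vec) := C1 ^ 2 / (2 * N q * (N q + pz q)) - Comega ^ 2 / (2 * k q).
(** Since [p] depends on the horizontal coordinates through their squared length, its horizontal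
    gradient is a common factor [al] times (px, py). *)
Let al (q : vec) :=
  Comega ^ 2 / k q ^ 2 - C1 ^ 2 * (2 * N q + pz q) / (2 * N q ^ 3 * (N q + pz q) ^ 2).
(** The z-derivative of N (N + z) is (N + z)^2 / N, which cancels the square of N + z in the
    denominator. *)
Let ze (q : vec) := - C1 ^ 2 / (2 * N q ^ 3).

Let N_pos (q : vec) : flow_domain q -> 0 < N q.
Proof. intros hq; apply flow_domain_iff in hq; apply sqrt_lt_R0; nra. Qed.

Let p_partials (q : vec) :
  flow_domain q ->
  is_derive (fun t : R => p (t, py q, pz q)) (px q) (px q * al q) /\
  is_derive (fun t : R => p (px q, t, pz q)) (py q) (py q * al q) /\
  is_derive (fun t : R => p (px q, py q, t)) (pz q) (ze q).
Proof.
intros hq; assert (hN := N_pos q hq); apply flow_domain_iff in hq.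
destruct q as [[x y] z]; unfold p, al, ze, k, N, px, py, pz in *; simpl fst in *; simpl snd in *.
assert (EN : sqrt (x * (x * 1) + y * (y * 1) + z * (z * 1)) = sqrt (x ^ 2 + y ^ 2 + z ^ 2))
  by reflexivity.
assert (Ek : x * (x * 1) + y * (y * 1) = x ^ 2 + y ^ 2) by reflexivity.
assert (Em : x * (x * 1) + y * (y * 1) + z * (z * 1) = x ^ 2 + y ^ 2 + z ^ 2) by reflexivity.
assert (E2 : sqrt (x ^ 2 + y ^ 2 + z ^ 2) ^ 2 = x ^ 2 + y ^ 2 + z ^ 2)
  by (apply pow2_sqrt; nra).
assert (hm : 0 < x ^ 2 + y ^ 2 + z ^ 2) by nra.
assert (hk : x ^ 2 + y ^ 2 <> 0) by lra.
refine (conj _ (conj _ _)).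
- auto_derive; rewrite ?EN, ?Em, ?Ek;
    [|revert hk hN; generalize (sqrt (x ^ 2 + y ^ 2 + z ^ 2)); intros; field; lra].
  assert (sqrt (x ^ 2 + y ^ 2 + z ^ 2) + z <> 0) by lra.
  repeat split; try exact hm; repeat apply Rmult_integral_contrapositive_currified; lra.
- auto_derive; rewrite ?EN, ?Em, ?Ek;
    [|revert hk hN; generalize (sqrt (x ^ 2 + y ^ 2 + z ^ 2)); intros; field; lra].
  assert (sqrt (x ^ 2 + y ^ 2 + z ^ 2) + z <> 0) by lra.
  repeat split; try exact hm; repeat apply Rmult_integral_contrapositive_currified; lra.
- auto_derive; rewrite ?EN, ?Em, ?Ek;
    [|revert hk hN; generalize (sqrt (x ^ 2 + y ^ 2 + z ^ 2)); intros; field; lra].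
  assert (sqrt (x ^ 2 + y ^ 2 + z ^ 2) + z <> 0) by lra.
  repeat split; try exact hm; repeat apply Rmult_integral_contrapositive_currified; lra.
Qed.

Let p_grad (q : vec) : flow_domain q -> grad p q = (px q * al q, py q * al q, ze q).
Proof.
intros hq; destruct (p_partials q hq) as (h1 & h2 & h3).
unfold grad, Dx, Dy, Dz.
now rewrite (is_derive_unique _ _ _ h1), (is_derive_unique _ _ _ h2), (is_derive_unique _ _ _ h3).
Qed.

Lemma continuous_Rdiv {U : UniformSpace} (f g : U -> R) (u : U) :
  continuous f u -> continuous g u -> g u <> 0 -> continuous (fun v => f v / g v) u.
Proof.
intros hf hg h0; apply (continuous_mult f (fun v => / g v)); [exact hf|].
exact (continuous_comp g Rinv u hg (continuous_Rinv (g u) h0)).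
Qed.

Let al_ze_continuous (q : vec) : flow_domain q -> continuous al q /\ continuous ze q.
Proof.
intros hq; assert (hN := N_pos q hq); apply flow_domain_iff in hq; destruct hq as [hk hz].
assert (cx := continuous_px q); assert (cy := continuous_py q); assert (cz := continuous_pz q).
assert (ck : continuous k q).
{ apply (continuous_plus (fun s => px s ^ 2) (fun s => py s ^ 2)); now apply continuous_pow. }
assert (cN : continuous N q).
{ apply (continuous_comp (fun s => px s ^ 2 + py s ^ 2 + pz s ^ 2) sqrt); [|apply continuous_sqrt].
  apply (continuous_plus k (fun s => pz s ^ 2)); [exact ck|now apply continuous_pow]. }
assert (cNz : continuous (fun s => N s + pz s) q) by (now apply (continuous_plus N pz)).
assert (c3 : continuous (fun s => 2 * N s ^ 3) q).
{ apply (continuous_mult (fun _ => 2) (fun s => N s ^ 3)); [apply continuous_const|].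
  now apply continuous_pow. }
assert (h3 : 0 < N q ^ 3) by (now apply pow_lt).
assert (h2 : 0 < (N q + pz q) ^ 2) by (apply pow_lt; lra).
split.
- apply (continuous_minus (fun s => Comega ^ 2 / k s ^ 2)
    (fun s => C1 ^ 2 * (2 * N s + pz s) / (2 * N s ^ 3 * (N s + pz s) ^ 2))).
  + apply continuous_Rdiv; [apply continuous_const|now apply continuous_pow|].
    apply pow_nonzero; unfold k; lra.
  + apply continuous_Rdiv.
    * apply (continuous_mult (fun _ => C1 ^ 2) (fun s => 2 * N s + pz s));
        [apply continuous_const|].
      apply (continuous_plus (fun s => 2 * N s) pz); [|exact cz].
      apply (continuous_mult (fun _ => 2) N); [apply continuous_const|exact cN].
    * apply (continuous_mult (fun s => 2 * N s ^ 3) (fun s => (N s + pz s) ^ 2)); [exact c3|].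
      now apply continuous_pow.
    * apply Rmult_integral_contrapositive_currified; lra.
- apply continuous_Rdiv; [apply continuous_const|exact c3|lra].
Qed.

Lemma C1_closed_form_pressure : C1_on flow_domain p.
Proof.
intros q hq; split.
{ destruct (p_partials q hq) as (h1 & h2 & h3).
  refine (conj _ (conj _ _)); eexists; eassumption. }
destruct (al_ze_continuous q hq) as [ca cz].
assert (l := flow_domain_open q hq).
assert (E : forall s, flow_domain s ->
  px s * al s = Dx p s /\ py s * al s = Dy p s /\ ze s = Dz p s).
{ intros s' hs; assert (h := p_grad s' hs); unfold grad in h; now inversion h. }
refine (conj _ (conj _ _)).
- apply continuous_ext_loc with (fun s => px s * al s).
  + revert l; apply filter_imp; intros s' hs; now apply E.
  + apply (continuous_mult px al); [apply continuous_px|exact ca].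
- apply continuous_ext_loc with (fun s => py s * al s).
  + revert l; apply filter_imp; intros s' hs; now apply E.
  + apply (continuous_mult py al); [apply continuous_py|exact ca].
- apply continuous_ext_loc with ze; [|exact cz].
  revert l; apply filter_imp; intros s' hs; now apply E.
Qed.

Lemma steady_euler_closed_form : steady_euler flow_domain (conical F G Om) p.
Proof.
intros q hq; assert (Ep := p_grad q hq).
assert (hq' := hq).
destruct hq' as (rho & a & th & hrho & ha & Eq).
destruct (sin_cos_pos _ ha) as [hs hc].
set (x := cos a) in *.
assert (dF : is_derive F x (F1 x)).
{ apply is_derive_ext_loc with F0; [|now apply is_derive_closed_form_F].
  generalize (locally_01 x hc); apply filter_imp; intros t ht; symmetry; now apply F_def. }
assert (dG : is_derive G x (G1 x)).
{ apply is_derive_ext_loc with G0; [|now apply DG0].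
  generalize (locally_01 x hc); apply filter_imp; intros t ht; symmetry; now apply G_def. }
assert (dO : is_derive Om x 0).
{ apply is_derive_ext_loc with (fun _ => Comega); [|apply is_derive_Rconst].
  generalize (locally_01 x hc); apply filter_imp; intros t ht; symmetry; now apply Om_def. }
destruct (conical_spherical F G Om rho a _ _ _ hrho ha dF dG dO th)
  as ((e1 & e2 & e3) & h0 & h1 & h2 & h3).
rewrite <- Eq in e1, e2, e3, h0, h1, h2, h3; fold x in h0, h1, h2, h3.
rewrite F_def, G_def, Om_def in * by exact hc.
assert (hr : r x = sin a) by (now apply sqrt_1_minus_cos2).
assert (hS := sin_cos_sqr a); fold x in hS.
(* [Q0], [Q1], [Q2] are H, H'/2 and H''/2 for H = C1^2 x (1 - x). Once [G] is eliminated, the forces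
   involve [F] through these alone, so the square root disappears before [field] compares with the
   pressure gradient. *)
assert (Q0 : F0 x ^ 2 = C1 ^ 2 * (x * (1 - x))).
{ unfold F0; rewrite Rpow_mult_distr, s_sqr by exact hc; ring. }
assert (hsx := s_pos x hc).
assert (Q1 : F0 x * F1 x = C1 ^ 2 * (1 - 2 * x) / 2) by (unfold F0, F1; field; lra).
assert (Q2 : F1 x ^ 2 + F0 x * F2 x = - C1 ^ 2).
{ unfold F0, F1, F2; rewrite <- (s_sqr x hc).
  field_simplify_eq; [|lra]; rewrite s_sqr by exact hc; ring. }
assert (hN : N q = rho).
{ unfold N; rewrite Eq; unfold sph, px, py, pz; simpl fst; simpl snd.
  replace (_ + _) with (rho ^ 2) by (ring [(sin_cos_sqr th) (sin_cos_sqr a)]).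
  apply sqrt_pow2; lra. }
assert (hk : k q = (rho * sin a) ^ 2).
{ unfold k; rewrite Eq; unfold sph, px, py, pz; simpl fst; simpl snd.
  ring [(sin_cos_sqr th)]. }
assert (hz : pz q = rho * x) by (now rewrite Eq).
refine (conj e1 (conj e2 (conj e3 (conj _ _)))).
- replace (- Dx p q, - Dy p q, - Dz p q) with (- (px q * al q), - (py q * al q), - ze q)
    by (unfold grad in Ep; now inversion Ep).
  assert (xq : px q = rho * sin a * cos th) by (now rewrite Eq).
  assert (yq : py q = rho * sin a * sin th) by (now rewrite Eq).
  unfold al, ze; rewrite hN, hk, hz, xq, yq.
  assert (A : radial_force x (sin a) (F0 x) (G0 x) (G1 x) Comega
    = (F1 x ^ 2 + F0 x * F2 x) + (F0 x ^ 2 + Comega ^ 2) / sin a ^ 2).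
  { unfold radial_force, G0, G1; rewrite hr; field [hS]; lra. }
  assert (B : polar_force x (sin a) (F0 x) (F1 x) Comega
    = (F0 x * F1 x) / sin a + x * (F0 x ^ 2 + Comega ^ 2) / sin a ^ 3) by reflexivity.
  rewrite Q0, Q2 in A; rewrite Q0, Q1 in B.
  assert (hx1 : rho + rho * x <> 0) by nra.
  assert (Et := sin_cos_sqr th).
  apply (frame_eq a th); [rewrite h1, A|rewrite h2, B|rewrite h3];
    unfold dot, e_R, e_alpha, e_theta, px, py, pz; simpl fst; simpl snd; fold x;
    revert Et hS hs hx1; clear - hrho hc; clearbody x;
    generalize (sin a) (cos th) (sin th); intros S ct st Et hS hs hx1.
  + field [Et hS]; repeat split; nra.
  + field [Et hS]; repeat split; nra.
  + field [Et]; lra.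
- rewrite h0; unfold G0; rewrite hr; field; lra.
Qed.

End Sufficiency.

(** * The two directions of the equivalence *)

Lemma Cn_01_is_derive (n k : nat) (f : R -> R) (x : R) :
  Cn_01 n f -> (k < n)%nat -> 0 < x < 1 -> is_derive (Derive_n f k) x (Derive_n f (S k) x).
Proof. intros h hk hx; apply Derive_correct; exact (proj1 (h (S k) x hk hx)). Qed.

Theorem mainTheorem3 :
  forall Comega : R, Comega <> 0 ->
  forall F G Omega : R -> R,
    (classical_solution F G Omega /\
     filterlim F (at_right 0) (locally 0) /\
     filterlim F (at_left 1) (locally 0) /\
     filterlim Omega (at_left 1) (locally Comega))
    <->
    (exists C1 : R, forall x : R, 0 < x < 1 ->
       Omega x = Comega /\
       F x = C1 * sqrt (x * (1 - x)) /\
       G x = C1 * (((1 - 2 * x) * sqrt (1 + x)) / (2 * sqrt x))).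
Proof.
intros Comega hC F G Om; split.
- intros (hsol & l0 & l1 & lO).
  apply classical_solution_iff in hsol; destruct hsol as (cF & cG & cO & p & hp & he).
  assert (DF : forall x, 0 < x < 1 -> is_derive F x (Derive_n F 1 x))
    by (intros x hx; apply (Cn_01_is_derive 3 0 F x cF); [lia|exact hx]).
  assert (DF1 : forall x, 0 < x < 1 -> is_derive (Derive_n F 1) x (Derive_n F 2 x))
    by (intros x hx; apply (Cn_01_is_derive 3 1 F x cF); [lia|exact hx]).
  assert (DF2 : forall x, 0 < x < 1 -> is_derive (Derive_n F 2) x (Derive_n F 3 x))
    by (intros x hx; apply (Cn_01_is_derive 3 2 F x cF); [lia|exact hx]).
  assert (DG : forall x, 0 < x < 1 -> is_derive G x (Derive_n G 1 x))
    by (intros x hx; apply (Cn_01_is_derive 2 0 G x cG); [lia|exact hx]).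
  assert (DO : forall x, 0 < x < 1 -> is_derive Om x (Derive_n Om 1 x))
    by (intros x hx; apply (Cn_01_is_derive 1 0 Om x cO); [lia|exact hx]).
  assert (CO : forall x, 0 < x < 1 -> continuous (Derive_n Om 1) x)
    by (intros x hx; apply (cO 1%nat x); [lia|exact hx]).
  destruct (F_closed_form F _ _ _ G _ Om _ p DF DF1 DF2 DG DO CO hp he l0 l1) as [C1 hF].
  exists C1; intros x hx; refine (conj _ (conj (hF x hx) _)).
  + exact (Om_eq_Comega F _ _ _ G _ Om _ p DF DF1 DF2 DG DO CO hp he Comega hC lO x hx).
  + rewrite closed_form_G by exact hx.
    (* Incompressibility determines [G] from F', so it remains to differentiate the closed form of
       [F]. *)
    rewrite (div_free_G F _ G _ Om _ p DF DG DO he x hx); f_equal.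
    apply (is_derive_eq F x); [now apply DF|].
    apply is_derive_ext_loc with (fun t => C1 * sqrt (t * (1 - t))).
    * generalize (locally_01 x hx); apply filter_imp; intros t ht; symmetry; now apply hF.
    * now apply is_derive_closed_form_F.
- intros (C1 & h).
  assert (hF : forall x, 0 < x < 1 -> F x = C1 * sqrt (x * (1 - x))) by (intros x hx; now apply h).
  assert (hO : forall x, 0 < x < 1 -> Om x = Comega) by (intros x hx; now apply h).
  assert (hG : forall x, 0 < x < 1 ->
    G x = sqrt (1 - x ^ 2) * (C1 * (1 - 2 * x) / (2 * sqrt (x * (1 - x)))))
    by (intros x hx; rewrite <- closed_form_G by exact hx; now apply h).
  (* Both ends are treated at once: [y] is a root of y (1 - y), and sqrt (t (1 - t)) is continuous
     there because [sqrt] is continuous at 0 as well. *)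
  assert (LF : forall (Fl : (R -> Prop) -> Prop) y, Filter Fl -> Fl (fun t => 0 < t < 1) ->
    filterlim (fun t => t) Fl (locally y) -> y * (1 - y) = 0 -> filterlim F Fl (locally 0)).
  { intros Fl y FFl l01 hy Ey.
    apply filterlim_ext_loc with (fun t => C1 * sqrt (t * (1 - t))).
    - revert l01; apply filter_imp; intros t ht; symmetry; now apply hF.
    - replace 0 with (C1 * sqrt (y * (1 - y))) by (rewrite Ey, sqrt_0; ring).
      apply (filterlim_comp _ _ _ (fun t => t) (fun t => C1 * sqrt (t * (1 - t))) Fl (locally y));
        [exact hy|].
      apply (continuous_mult (fun _ => C1) (fun t : R => sqrt (t * (1 - t))));
        [apply continuous_const|].
      apply (continuous_comp (fun t : R => t * (1 - t)) sqrt); [|apply continuous_sqrt].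
      apply (ex_derive_continuous (fun t : R => t * (1 - t))); auto_derive; easy. }
  refine (conj _ (conj _ (conj _ _))).
  + apply classical_solution_iff.
    refine (conj (Cn_closed_form_F C1 F hF) (conj (Cn_closed_form_G C1 G hG)
      (conj (Cn_const_Om Comega Om hO) _))).
    eexists; split;
      [exact (C1_closed_form_pressure C1 Comega)
      |exact (steady_euler_closed_form C1 Comega F G Om hF hG hO)].
  + apply (LF _ 0); [apply filter_filter|exact at_right_0_01| |ring].
    intros P hP; exact (filter_imp _ _ (fun t ht _ => ht) hP).
  + apply (LF _ 1); [apply filter_filter|exact at_left_1_01| |ring].
    intros P hP; exact (filter_imp _ _ (fun t ht _ => ht) hP).
  + apply filterlim_ext_loc with (fun _ => Comega); [|apply filterlim_const].
    generalize at_left_1_01; apply filter_imp; intros t ht; symmetry; now apply hO.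
Qed.
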